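(* Let $N\ge2$ and let $\mu$ and $\mu'$ be two quasi-stationary Markov measures on $\mathcal K_N$. Then $\mu$ and $\mu'$ are either equivalent or mutually singular. The corresponding representations of $\mathcal O_N$ (on $L^2(\mu)$ and $L^2(\mu')$) are either equivalent or disjoint.
   Context: $\mathbb N=\{1,2,\dots\}$, $\mathbb Z_N=\{0,1,\dots,N-1\}$, and $\mathcal K_N=\mathbb Z_N^{\mathbb N}$ is the set of infinite words $x_1x_2\dots$ over $\mathbb Z_N$, with the product topology and Borel sigma-algebra. The shift is $\sigma(x_1x_2\dots)=x_2x_3\dots$. For a finite word $I=i_1\dots i_n$, the cylinder set is $\mathcal C(I)=\{x\in\mathcal K_N:x_1=i_1,\dots,x_n=i_n\}$. Markov measures: a matrix is stochastic if each row sums to $1$. Let $\lambda=(\lambda_0,\dots,\lambda_{N-1})$ be a row vector with $\lambda_i>0$ and $\sum_i\lambda_i=1$, and let $T=\{T^{(n)}\}_{n\in\mathbb N}$ be a sequence of stochastic $N\times N$ matrices with $T^{(n)}_{i,j}>0$ for all $i,j\in\mathbb Z_N$, $n\in\mathbb N$, and such that $\lambda T^{(1)}=\lambda$. The Markov measure associated to $(\lambda,T)$ is the unique Borel probability measure $\mu$ on $\mathcal K_N$ with $$\mu(\mathcal C(i_1\dots i_n))=\lambda_{i_1}T^{(1)}_{i_1,i_2}T^{(2)}_{i_2,i_3}\cdots T^{(n-1)}_{i_{n-1},i_n}$$ for all finite words. It is quasi-stationary if $$\sum_{n=1}^\infty\left|\frac{T^{(n)}_{x_n,x_{n+1}}}{T^{(n+1)}_{x_n,x_{n+1}}}-1\right|<\infty\quad\text{for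 all }x_1x_2\dots\in\mathcal K_N.$$ Associated representation: a representation of the Cuntz algebra $\mathcal O_N$ on a Hilbert space is given by operators $(S_i)_{i\in\mathbb Z_N}$ with $S_i^*S_j=\delta_{ij}I$ and $\sum_{i}S_iS_i^*=I$. The representation corresponding to the quasi-stationary Markov measure $\mu$ associated to $(\lambda,T)$ is the one on $L^2(\mu)$ given by $S_jf=f_j\,(f\circ\sigma)$, where $$f_j(x_1x_2\dots)=\delta_{j,x_1}\sqrt{\frac{\lambda_{x_2}}{\lambda_{x_1}T^{(1)}_{x_1,x_2}}F(x_2x_3\dots)},\qquad F(x_1x_2\dots)=\prod_{n=1}^\infty\frac{T^{(n)}_{x_n,x_{n+1}}}{T^{(n+1)}_{x_n,x_{n+1}}}$$ (the product converges to a number in $(0,\infty)$, and the $S_j$ do form a representation of $\mathcal O_N$). Two measures are equivalent if they are mutually absolutely continuous. Two representations $(S_i)$ on $\mathcal H$ and $(S_i')$ on $\mathcal H'$ are equivalent if there is a unitary $W:\mathcal H\to\mathcal H'$ with $WS_i=S_i'W$ for all $i$; they are disjoint if the only bounded operator $W:\mathcal H\to\mathcal H'$ with $WS_i=S_i'W$ and $WS_i^*=S_i'^*W$ for all $i$ is $W=0$. *)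

(* Defs.v *)
From HB Require Import structures.
From mathcomp Require Import all_boot all_order all_algebra.
From mathcomp Require Import sesquilinear ring_quotient generic_quotient.
From mathcomp Require Import complex.
From mathcomp Require Import all_classical all_reals all_analysis.

Set Implicit Arguments.
Unset Strict Implicit.
Unset Printing Implicit Defensive.

Import Order.TTheory GRing.Theory Num.Theory.
Import numFieldNormedType.Exports.

Local Open Scope classical_set_scope.
Local Open Scope ring_scope.

Local Notation conjC := Num.conj.

Section ComplexL2.
Context {d : measure_display} {T : measurableType d} {R : realType}.
Variable mu : {measure set T -> \bar R}.
Local Notation C := R[i].
Local Notation Re := (@complex.Re R).
Local Notation Im := (@complex.Im R).
Local Notation L2R := (Lfun mu 2%:E).

(* A complex function is in L^2(mu) iff its real and imaginary parts are. The
   codomain is C^o so that functions inherit their C-module structure. *)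
Definition finL2 : {pred (T -> C^o)} :=
  fun f => (Re \o f \in L2R) && (Im \o f \in L2R).

Lemma finL2_submod_closed : submod_closed finL2.
Proof.
have [L0 LP] := Lfun_submod_closed mu (lee1n 2).
have LD (f g : T -> R) : f \in L2R -> g \in L2R -> f + g \in L2R.
  by move=> fL gL; have := LP 1 f g fL gL; rewrite scale1r.
have LZ (a : R) (f : T -> R) : f \in L2R -> a *: f \in L2R.
  by move=> fL; have := LP a f 0 fL L0; rewrite addr0.
split=> [|a f g /andP[f1 f2] /andP[g1 g2]]; first by apply/andP; split.
apply/andP; split.
- have -> : Re \o (a *: f + g) =
      Re a *: (Re \o f) + (- Im a) *: (Im \o f) + (Re \o g).
    apply/funext => x /=; rewrite !fctE /=.
    case: a (f x) (g x) => a1 a2 [u1 u2] [v1 v2] /=.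
    by rewrite /GRing.scale /= mulNr.
  by rewrite !(LD, LZ).
- have -> : Im \o (a *: f + g) =
      Re a *: (Im \o f) + Im a *: (Re \o f) + (Im \o g).
    apply/funext => x /=; rewrite !fctE /=.
    case: a (f x) (g x) => a1 a2 [u1 u2] [v1 v2] /=.
    by rewrite /GRing.scale.
  by rewrite !(LD, LZ).
Qed.

HB.instance Definition _ :=
  GRing.isSubmodClosed.Build C (T -> C^o) finL2 finL2_submod_closed.

Definition funL2 := {f : T -> C^o | finL2 f}.
HB.instance Definition _ := SubChoice.on funL2.
HB.instance Definition _ := [SubChoice_isSubLmodule of funL2 by <:].

Definition evL2 (f : funL2) : T -> C := val f.

Lemma funL20 x : evL2 0 x = 0.
Proof. by rewrite /evL2 GRing.val0. Qed.

Lemma funL2B (f g : funL2) x : evL2 (f - g) x = evL2 f x - evL2 g x.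
Proof. by rewrite /evL2 GRing.valB. Qed.

Lemma funL2Z a (f : funL2) x : evL2 (a *: f) x = a * evL2 f x.
Proof. by rewrite /evL2 GRing.valZ. Qed.

Lemma funL2P a (f g : funL2) x : evL2 (a *: f + g) x = a * evL2 f x + evL2 g x.
Proof. by rewrite /evL2 GRing.valD GRing.valZ. Qed.

(* L^2(mu) is the quotient of the square-integrable functions by those that
   vanish almost everywhere. *)
Definition nullL2 : {pred funL2} :=
  fun f => `[< {ae mu, forall x, evL2 f x = 0} >].

Lemma nullL2_zmod_closed : zmod_closed nullL2.
Proof.
split=> [|f g /asboolP f0 /asboolP g0]; apply/asboolP.
  by apply: aeW => x; rewrite funL20.
by apply: filterS2 f0 g0 => x; rewrite funL2B => -> ->; rewrite subr0.
Qed.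

HB.instance Definition _ :=
  GRing.isZmodClosed.Build funL2 nullL2 nullL2_zmod_closed.

Definition L2 := Quotient.quot nullL2.
HB.instance Definition _ := GRing.Zmodule.on L2.
HB.instance Definition _ := EqQuotient.on L2.

Local Open Scope quotient_scope.

Lemma L2P (f g : funL2) :
  \pi_L2 f = \pi_L2 g <-> {ae mu, forall x, evL2 f x = evL2 g x}.
Proof.
have E x : (evL2 (f - g) x == 0) = (evL2 f x == evL2 g x).
  by rewrite funL2B subr_eq0.
have Q : (\pi_L2 f == \pi_L2 g) = (f - g \in nullL2).
  by rewrite Quotient.idealrBE.
split=> [/eqP|h].
  rewrite Q => /asboolP h.
  by apply: filterS h => x /eqP; rewrite E => /eqP.
apply/eqP; rewrite Q; apply/asboolP.
by apply: filterS h => x /eqP; rewrite -E => /eqP.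
Qed.

Definition scaleL2 (a : C) (f : L2) : L2 := \pi_L2 (a *: repr f).

Lemma reprL2 (f : funL2) : {ae mu, forall x, evL2 (repr (\pi_L2 f)) x = evL2 f x}.
Proof. by apply/L2P; rewrite reprK. Qed.

Lemma pi_scaleL2 a (f : funL2) : scaleL2 a (\pi_L2 f) = \pi_L2 (a *: f).
Proof.
by apply/L2P; apply: filterS (reprL2 f) => x; rewrite !funL2Z => ->.
Qed.

Lemma pi_addL2 (f g : funL2) : \pi_L2 f + \pi_L2 g = \pi_L2 (f + g).
Proof. by rewrite [RHS]Quotient.pi_add. Qed.

Lemma scaleL2A a b (f : L2) : scaleL2 a (scaleL2 b f) = scaleL2 (a * b) f.
Proof.
by rewrite -[f]reprK (pi_scaleL2 b) !pi_scaleL2 scalerA.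
Qed.

Lemma scaleL21 : left_id 1 scaleL2.
Proof. by move=> f; rewrite -[f]reprK pi_scaleL2 scale1r. Qed.

Lemma scaleL2Dr : right_distributive scaleL2 +%R.
Proof.
move=> a f g; rewrite -[f]reprK -[g]reprK.
by rewrite pi_addL2 !pi_scaleL2 pi_addL2 scalerDr.
Qed.

Lemma scaleL2Dl f : {morph scaleL2^~ f : a b / a + b}.
Proof.
by move=> a b; rewrite -[f]reprK !pi_scaleL2 pi_addL2 scalerDl.
Qed.

HB.instance Definition _ := GRing.Zmodule_isLmodule.Build C L2
  scaleL2A scaleL21 scaleL2Dr scaleL2Dl.

Lemma pi_ZL2 a (f : funL2) : a *: \pi_L2 f = \pi_L2 (a *: f).
Proof. exact: pi_scaleL2. Qed.

Definition Cintegral (h : T -> C) : C :=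
  ((\int[mu]_x Re (h x)) +i* (\int[mu]_x Im (h x)))%C.

Definition dotL2 (f g : L2) : C :=
  Cintegral (fun x => evL2 (repr f) x * conjC (evL2 (repr g) x)).

Lemma conjcE (z : C) : conjC z = (Re z -i* Im z)%C.
Proof. by case: z. Qed.

Lemma mulcE (z w : C) :
  z * w = ((Re z * Re w - Im z * Im w) +i* (Re z * Im w + Im z * Re w))%C.
Proof. by case: z w => ? ? [? ?]. Qed.

Definition Cintegrable (h : T -> C) : Prop :=
  mu.-integrable setT (EFin \o (Re \o h)) /\
  mu.-integrable setT (EFin \o (Im \o h)).

Lemma CintegralD (a : C) (h k : T -> C) : Cintegrable h -> Cintegrable k ->
  Cintegral (fun x => a * h x + k x) = a * Cintegral h + Cintegral k.
Proof.
move=> [h1 h2] [k1 k2].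
have Z (r : R) (u : T -> R) : mu.-integrable setT (EFin \o u) ->
    mu.-integrable setT (EFin \o (fun x => r * u x)).
  move=> iu; have := integrableZl measurableT r iu; exact: eq_integrable.
have D (u v : T -> R) : mu.-integrable setT (EFin \o u) ->
    mu.-integrable setT (EFin \o v) ->
    mu.-integrable setT (EFin \o (fun x => u x + v x)).
  move=> iu iv; have := integrableD measurableT iu iv; exact: eq_integrable.
rewrite /Cintegral mulcE /=; congr Complex.
- rewrite (_ : (fun x => Re (a * h x + k x)) =
     (fun x => Re a * Re (h x) + (- Im a * Im (h x)) + Re (k x))).
    rewrite (RintegralD measurableT (D _ _ (Z _ _ h1) (Z _ _ h2)) k1).
    rewrite (RintegralD measurableT (Z _ _ h1) (Z _ _ h2)).
    by rewrite (RintegralZl _ measurableT h1) (RintegralZl _ measurableT h2) mulNr.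
  by apply/funext => x; case: a (h x) (k x) => ? ? [? ?] [? ?] /=; rewrite mulNr.
- rewrite (_ : (fun x => Im (a * h x + k x)) =
     (fun x => Re a * Im (h x) + (Im a * Re (h x)) + Im (k x))).
    rewrite (RintegralD measurableT (D _ _ (Z _ _ h2) (Z _ _ h1)) k2).
    rewrite (RintegralD measurableT (Z _ _ h2) (Z _ _ h1)).
    by rewrite (RintegralZl _ measurableT h1) (RintegralZl _ measurableT h2).
  by apply/funext => x; case: a (h x) (k x) => ? ? [? ?] [? ?].
Qed.

Lemma Cintegral_conj (h : T -> C) : Cintegrable h ->
  Cintegral (fun x => conjC (h x)) = conjC (Cintegral h).
Proof.
move=> [h1 h2]; rewrite /Cintegral conjcE /=; congr Complex.
  by apply: eq_Rintegral => x _; rewrite conjcE.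
rewrite -mulN1r -RintegralZl //.
by apply: eq_Rintegral => x _; rewrite conjcE mulN1r.
Qed.

Lemma Cintegrable_mulL2 (f g : funL2) :
  Cintegrable (fun x => evL2 f x * conjC (evL2 g x)).
Proof.
have /andP[f1 f2] := valP f; have /andP[g1 g2] := valP g.
have M (u v : T -> R) : u \in L2R -> v \in L2R ->
  mu.-integrable setT (EFin \o (fun x => u x * v x)).
  by move=> uL vL; apply/Lfun1_integrable/Lfun2_mul_Lfun1.
split.
  have := integrableD measurableT (M _ _ f1 g1) (M _ _ f2 g2); apply: eq_integrable => //.
  by move=> x _ /=; rewrite conjcE mulcE /= mulrN opprK.
have := integrableB measurableT (M _ _ f2 g1) (M _ _ f1 g2); apply: eq_integrable => //.
by move=> x _ /=; rewrite conjcE mulcE /= mulrN -EFinB addrC.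
Qed.

Lemma ae_eq_Cintegral (h k : T -> C) : Cintegrable h -> Cintegrable k ->
  {ae mu, forall x, h x = k x} -> Cintegral h = Cintegral k.
Proof.
move=> [h1 h2] [k1 k2] hk; congr Complex; congr fine.
- apply: ae_eq_integral => //; [exact: measurable_int h1|exact: measurable_int k1|].
  by apply: filterS hk => x /= ->.
- apply: ae_eq_integral => //; [exact: measurable_int h2|exact: measurable_int k2|].
  by apply: filterS hk => x /= ->.
Qed.

Lemma dot_piL2 (f g : funL2) :
  dotL2 (\pi_L2 f) (\pi_L2 g) = Cintegral (fun x => evL2 f x * conjC (evL2 g x)).
Proof.
apply: ae_eq_Cintegral; try exact: Cintegrable_mulL2.
by apply: filterS2 (reprL2 f) (reprL2 g) => x -> ->.
Qed.

Lemma dotL2_hermitian (f g : L2) : dotL2 f g = (-1) ^+ false * conjC (dotL2 g f).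
Proof.
rewrite expr0 mul1r -Cintegral_conj; last exact: Cintegrable_mulL2.
congr Cintegral; apply/funext => x.
by rewrite !conjcE !mulcE /=; congr Complex; rewrite ?mulrN ?mulNr ?opprK;
  [congr (_ + _)|rewrite opprD opprK addrC; congr (_ - _)]; rewrite mulrC.
Qed.

Lemma dotL2Pl (h : L2) (a : C) (f g : L2) :
  dotL2 (a *: f + g) h = a * dotL2 f h + dotL2 g h.
Proof.
rewrite -[f]reprK -[g]reprK -[h]reprK pi_ZL2 pi_addL2 !dot_piL2.
rewrite -CintegralD; try exact: Cintegrable_mulL2.
congr Cintegral; apply/funext => x.
by rewrite funL2P mulrDl mulrA.
Qed.

Lemma dotL2Pr (h : L2) (a : C) (f g : L2) :
  dotL2 h (a *: f + g) = conjC a * dotL2 h f + dotL2 h g.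
Proof.
rewrite dotL2_hermitian dotL2Pl (dotL2_hermitian h f) (dotL2_hermitian h g).
by rewrite !expr0 !mul1r (rmorphD conjC) (rmorphM conjC).
Qed.

HB.instance Definition _ := bilinear_isBilinear.Build C L2 L2 C
  *%R (conjC \; *%R) dotL2 (dotL2Pl, dotL2Pr).

HB.instance Definition _ := isHermitianSesquilinear.Build C L2
  false conjC dotL2 dotL2_hermitian.

Lemma dotL2_gt0 (f : L2) : f != 0 -> 0 < dotL2 f f.
Proof.
rewrite -[f]reprK dot_piL2; set F := repr f => F0.
have [iF _] := Cintegrable_mulL2 F F.
pose q x := Re (evL2 F x) ^+ 2 + Im (evL2 F x) ^+ 2.
have qE : (fun x => evL2 F x * conjC (evL2 F x)) = (fun x => (q x)%:C%C).
  apply/funext => x; rewrite conjcE mulcE /=; congr Complex.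
    by rewrite mulrN opprK.
  by rewrite mulrN [Im _ * _]mulrC addNr.
have q0 x : 0 <= q x by rewrite addr_ge0 // sqr_ge0.
have iq : mu.-integrable setT (EFin \o q) by move: iF; rewrite qE.
have -> : Cintegral (fun x => evL2 F x * conjC (evL2 F x)) =
    (\int[mu]_x q x)%:C%C.
  rewrite qE /Cintegral; congr Complex.
  by rewrite /Rintegral integral0.
rewrite ltcR lt_neqAle Rintegral_ge0 // andbT; apply: contra_neq F0 => iq0.
transitivity (\pi_L2 (0 : funL2)); last by rewrite piE.
apply/L2P.
have : (\int[mu]_x `|(EFin \o q) x|)%E = 0%E.
  under eq_integral do rewrite gee0_abs ?lee_fin //.
  have := integrable_fin_num measurableT iq.
  by move=> /fineK <-; congr EFin.
move=> /(ae_eq_integral_abs mu measurableT (measurable_int _ iq)).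
apply: filterS => x /(_ I) /= [] /eqP.
rewrite paddr_eq0 ?sqr_ge0 // !sqrf_eq0 => /andP[/eqP re0 /eqP im0].
by rewrite funL20; apply/eqP; rewrite eq_complex re0 im0 eqxx.
Qed.

HB.instance Definition _ := isDotProduct.Build C L2 dotL2 dotL2_gt0.
End ComplexL2.

(* A complex Hilbert space is given by a C-module U and a positive definite
   Hermitian form dot on it, linear in the first argument. Completeness plays no
   role in the definitions below and is not part of the data; they are applied to
   L^2 spaces, which are complete. *)
Section Operators.
Context {R : realType}.
Local Notation C := R[i].

Definition hnorm {U : lmodType C} (dot : {dot U for conjC}) (u : U) : C :=
  sqrtC (dot u u).

Definition bounded_operator {U V : lmodType C} (dotU : {dot U for conjC})
    (dotV : {dot V for conjC}) (W : {linear U -> V}) : Prop :=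
  exists M : R, forall u, hnorm dotV (W u) <= M%:C%C * hnorm dotU u.

Definition unitary_operator {U V : lmodType C} (dotU : {dot U for conjC})
    (dotV : {dot V for conjC}) (W : {linear U -> V}) : Prop :=
  bijective W /\ isometry dotV dotU W.

(* There is at most one such B, because dot is definite, and there is one
   whenever A is a bounded operator on a Hilbert space; the default value 0 is
   meant for other A only. *)
Definition adjoint {U : lmodType C} (dot : {dot U for conjC}) (A : U -> U) :
    U -> U :=
  xget (fun=> 0) [set B | forall u v, dot (A u) v = dot u (B v)].

Definition equivalent_representations {I : Type} {U V : lmodType C}
    (dotU : {dot U for conjC}) (dotV : {dot V for conjC})
    (S : I -> U -> U) (S' : I -> V -> V) : Prop :=
  exists W : {linear U -> V}, unitary_operator dotU dotV W /\
    forall i, W \o S i = S' i \o W.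

Definition disjoint_representations {I : Type} {U V : lmodType C}
    (dotU : {dot U for conjC}) (dotV : {dot V for conjC})
    (S : I -> U -> U) (S' : I -> V -> V) : Prop :=
  forall W : {linear U -> V}, bounded_operator dotU dotV W ->
    (forall i, W \o S i = S' i \o W) ->
    (forall i, W \o adjoint dotU (S i) = adjoint dotV (S' i) \o W) ->
    forall u, W u = 0.

End Operators.

Section Measures.
Context {d : measure_display} {T : measurableType d} {R : realType}.

Definition equivalent_measures (mu nu : set T -> \bar R) : Prop :=
  mu `<< nu /\ nu `<< mu.

Definition mutually_singular (mu nu : set T -> \bar R) : Prop :=
  exists A, [/\ measurable A, mu A = 0%E & nu (~` A) = 0%E].

End Measures.

(* Infinite words over the alphabet {0, ..., N - 1} with N = n.+2, which ranges
   over all N >= 2. Positions are counted from 0: x_(k+1) is x k. *)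
Definition words (n : nat) : Type :=
  prod_topology (fun _ : nat => discrete_topology 'I_n.+2).

HB.instance Definition _ n := Topological.on (words n).
HB.instance Definition _ n := isPointed.Build (words n) (fun=> ord0).
(* Borel sigma-algebra *)
HB.instance Definition _ n :=
  Measurable.copy (words n) (g_sigma_algebraType (@open (words n))).

Section Markov.
Context {R : realType} {n : nat}.
Local Notation N := n.+2.
Local Notation K := (words n).

Definition word_shift (x : K) : K := fun k => x k.+1.

Definition cylinder (I : seq 'I_N) : set K := [set x | mkseq x (size I) = I].

(* T k stands for T^(k+1), the transition matrix from position k to k.+1. *)
Implicit Types (lam : 'rV[R]_N) (T : nat -> 'M[R]_N).

Definition markov_data lam T : Prop :=
  [/\ (forall i, 0 < lam ord0 i) /\ \sum_i lam ord0 i = 1,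
      forall k i, \sum_j T k i j = 1,
      forall k i j, 0 < T k i j
    & lam *m T 0%N = lam].

(* path_weight T k i (j1 :: j2 :: ...) is
   T k i j1 * T k.+1 j1 j2 * T k.+2 j2 j3 * ... *)
Fixpoint path_weight T (k : nat) (i : 'I_N) (I : seq 'I_N) : R :=
  if I is j :: J then T k i j * path_weight T k.+1 j J else 1.

Definition markov_measure lam T (mu : probability K R) : Prop :=
  forall i I, mu (cylinder (i :: I)) = (lam ord0 i * path_weight T 0 i I)%:E.

Definition step_ratio T (k : nat) (x : K) : R :=
  T k (x k) (x k.+1) / T k.+1 (x k) (x k.+1).

Definition quasi_stationary T : Prop :=
  forall x : K, (\sum_(0 <= k <oo) `|step_ratio T k x - 1|%:E < +oo)%E.

Definition prod_ratio T (x : K) : R := limn (fun m => \prod_(k < m) step_ratio T k x).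

Definition rep_weight lam T (j : 'I_N) (x : K) : R :=
  (x 0%N == j)%:R *
  Num.sqrt (lam ord0 (x 1%N) / (lam ord0 (x 0%N) * T 0%N (x 0%N) (x 1%N))
            * prod_ratio T (word_shift x)).

Local Open Scope quotient_scope.

(* S_j g = f_j * (g o sigma). For a quasi-stationary Markov measure mu this
   function is square-integrable, so the default value 0 of insubd is not used,
   and its class does not depend on the representative of g. *)
Definition markov_rep lam T (mu : probability K R) (j : 'I_N) (g : L2 mu) : L2 mu :=
  \pi_(L2 mu) (insubd (0 : funL2 mu)
    (fun x => (rep_weight lam T j x)%:C%C * evL2 (repr g) (word_shift x))).

End Markov.

Arguments dotL2 {d T R} mu f g.
Arguments markov_rep {R n} lam T mu j g.

(* Main.v *)
(* Comparing the transition matrices. Alternating words show that quasi-stationarity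
   makes T^(n)/T^(n+1) - 1 absolutely summable entrywise, so all the T^(n) have a
   common positive lower bound. If sum_n |T^(n) - T'^(n)|^2 is finite, the densities
   of mu' with respect to mu on words of length m are bounded in L^2(mu), hence
   mu' << mu, and symmetrically. If it is infinite, the sum over even n or over odd
   n diverges, and the Hellinger affinities of mu and mu' on words of length m tend
   to 0, because two consecutive steps lose a definite part of the row defects; then
   the measures are mutually singular.

   Comparing the representations. All the operators are weighted compositions
   f |-> w.(f o t): S_j, its adjoint, multiplication by the indicator of a cylinder,
   and, when mu << mu', the isometry given by w = sqrt(dmu/dmu') and t = id. The
   latter intertwines the representations because both products are weighted
   compositions with the shift inducing the same measure. When the measures are
   singular, an intertwiner W commutes with S_I S_I^* = 1_C(I), so
   |W u|^2 mu' <= M^2 |u|^2 mu on cylinders, hence |W u|^2 mu' << mu and W u = 0. *)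
From HB Require Import structures.
Require Import Defs.
From mathcomp Require Import all_boot all_order all_algebra.
From mathcomp Require Import sesquilinear generic_quotient.
From mathcomp Require Import complex ring lra.
From mathcomp Require Import all_classical all_reals all_analysis.
From mathcomp Require Import measurable_realfun.

Set Implicit Arguments.
Unset Strict Implicit.
Unset Printing Implicit Defensive.

Import Order.TTheory GRing.Theory Num.Theory.
Import numFieldNormedType.Exports.

Local Open Scope classical_set_scope.
Local Open Scope ring_scope.

(** * Weighted composition operators on L^2 *)

Section SquareIntegrable.
Context {d : measure_display} {T : measurableType d} {R : realType}.
Variable mu : {measure set T -> \bar R}.
Local Notation C := R[i].

Definition sqmod (z : C) : R := complex.Re z ^+ 2 + complex.Im z ^+ 2.

Lemma sqmod_ge0 z : 0 <= sqmod z.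
Proof. by rewrite addr_ge0// sqr_ge0. Qed.

Lemma sqmodM (a : R) (z : C) : sqmod (a%:C%C * z) = a ^+ 2 * sqmod z.
Proof. by case: z => x y; rewrite /sqmod /=; ring. Qed.

Lemma sqmod_eq0 z : sqmod z = 0 -> z = 0.
Proof.
move=> /eqP; rewrite paddr_eq0 ?sqr_ge0// !sqrf_eq0 => /andP[/eqP a0 /eqP b0].
by apply/eqP; rewrite eq_complex a0 b0 !eqxx.
Qed.

Lemma Lfun2P (f : T -> R) : f \in Lfun mu 2%:E <->
  measurable_fun setT f /\ (\int[mu]_x (f x ^+ 2)%:E < +oo)%E.
Proof.
split=> [fL|[mf fi]].
  split; first by move: fL; rewrite inE => /andP[/[!inE]].
  have /integrableP[_] := Lfun2_integrable_sqr fL; apply: le_lt_trans.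
  rewrite le_eqVlt; apply/orP; left; apply/eqP; apply: eq_integral => x _.
  by rewrite gee0_abs ?lee_fin ?sqr_ge0.
rewrite inE; apply/andP; split; rewrite inE//= /finite_norm unlock/=.
rewrite poweR_lty//; apply: le_lt_trans fi.
rewrite le_eqVlt; apply/orP; left; apply/eqP; apply: eq_integral => x _.
by rewrite powR_mulrn// real_normK ?num_real.
Qed.

Lemma finL2P (f : T -> C^o) : finL2 mu f <->
  [/\ measurable_fun setT (fun x => complex.Re (f x)),
      measurable_fun setT (fun x => complex.Im (f x)) &
      (\int[mu]_x (sqmod (f x))%:E < +oo)%E].
Proof.
have sq (g : T -> R) : measurable_fun setT g ->
    measurable_fun setT (fun x => (g x ^+ 2)%:E).
  by move=> mg; apply/measurable_EFinP; exact: measurable_funX.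
have s1 := sq (fun x => complex.Re (f x)).
have s2 := sq (fun x => complex.Im (f x)).
have sE x : (sqmod (f x))%:E =
    ((complex.Re (f x) ^+ 2)%:E + (complex.Im (f x) ^+ 2)%:E)%E by [].
split=> [/andP[/Lfun2P[m1 i1] /Lfun2P[m2 i2]]|[m1 m2 i]].
  split=> //; under eq_integral do rewrite sE.
  rewrite ge0_integralD//; first exact: lte_add_pinfty.
  - by move=> x _; rewrite lee_fin sqr_ge0.
  - by apply: s1; exact: m1.
  - by move=> x _; rewrite lee_fin sqr_ge0.
  - by apply: s2; exact: m2.
have ms : measurable_fun setT (fun x => (sqmod (f x))%:E).
  by under eq_fun do rewrite sE; apply: emeasurable_funD; [exact: s1|exact: s2].
apply/andP; split; apply/Lfun2P; split=> //; apply: le_lt_trans i.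
  apply: ge0_le_integral => //; [|exact: s1|].
    by move=> x _; rewrite lee_fin sqr_ge0.
  by move=> x _; rewrite lee_fin lerDl sqr_ge0.
apply: ge0_le_integral => //; [|exact: s2|].
  by move=> x _; rewrite lee_fin sqr_ge0.
by move=> x _; rewrite lee_fin lerDr sqr_ge0.
Qed.

End SquareIntegrable.

Section AlmostEverywhere.
Context {d : measure_display} {T : measurableType d} {R : realType}.
Variable mu : {measure set T -> \bar R}.

Lemma ae_and (P Q : T -> Prop) : {ae mu, forall x, P x} ->
  {ae mu, forall x, Q x} -> {ae mu, forall x, P x /\ Q x}.
Proof. by move=> hP hQ; apply: filterS2 hP hQ. Qed.

End AlmostEverywhere.

(** * Classes in L^2 and their representatives *)

Section ComplexIntegral.
Context {d : measure_display} {T : measurableType d} {R : realType}.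
Variable mu : {measure set T -> \bar R}.
Local Notation C := R[i].
Local Open Scope quotient_scope.

Lemma eqL2P (u v : L2 mu) :
  u = v <-> {ae mu, forall x, evL2 (repr u) x = evL2 (repr v) x}.
Proof. by rewrite -L2P !reprK. Qed.

Lemma evL2_lin a (u v : L2 mu) : {ae mu, forall x,
  evL2 (repr (a *: u + v)) x = a * evL2 (repr u) x + evL2 (repr v) x}.
Proof.
have := reprL2 (a *: repr u + repr v); rewrite -pi_addL2 -pi_ZL2 !reprK.
by apply: filterS => x ->; rewrite funL2P.
Qed.

Lemma evL2_0 : {ae mu, forall x, evL2 (repr (0 : L2 mu)) x = 0}.
Proof.
have := reprL2 (0 : funL2 mu).
have -> : \pi_(L2 mu) 0 = 0 :> L2 mu by rewrite piE.
by apply: filterS => x ->; rewrite funL20.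
Qed.

Lemma finL2_repr (u : L2 mu) : finL2 mu (evL2 (repr u)).
Proof. exact: valP. Qed.

(* [insubd] in the definition of the operators returns [0] outside L^2. *)
Lemma ae_insubd (f : T -> C^o) : finL2 mu f ->
  {ae mu, forall x, evL2 (repr (\pi_(L2 mu) (insubd (0 : funL2 mu) f))) x = f x}.
Proof.
move=> fL; have := reprL2 (insubd (0 : funL2 mu) f).
by apply: filterS => x ->; rewrite /evL2 insubdK.
Qed.

Lemma dotL2_sqmod (u : L2 mu) :
  dotL2 mu u u = (\int[mu]_x (sqmod (evL2 (repr u) x)))%:C%C.
Proof.
rewrite /dotL2 /Cintegral; congr Complex.
  by congr fine; apply: eq_integral => x _; rewrite conjcE mulcE /sqmod/=;
    congr EFin; ring.
rewrite /Rintegral integral0_eq// => x _; rewrite conjcE mulcE /=.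
by congr EFin; ring.
Qed.

Lemma integrable_sqmod (u : L2 mu) :
  mu.-integrable setT (fun x => (sqmod (evL2 (repr u) x))%:E).
Proof.
have /finL2P[m1 m2 i] := finL2_repr u.
apply/integrableP; split.
  apply/measurable_EFinP; apply: measurable_funD; exact: measurable_funX.
apply: le_lt_trans i; rewrite le_eqVlt; apply/orP; left; apply/eqP.
by apply: eq_integral => x _; rewrite gee0_abs// lee_fin sqmod_ge0.
Qed.

End ComplexIntegral.

(** * Contractive and isometric weights *)

Section WeightedComposition.
Context {d1 d2 : measure_display} {T1 : measurableType d1} {T2 : measurableType d2}.
Context {R : realType}.
Variables (mu1 : {measure set T1 -> \bar R}) (mu2 : {measure set T2 -> \bar R}).
Local Notation C := R[i].

(** The function [f] stands for $|u|^2$. Allowing every nonnegative measurable [f] with extended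
    values lets the same condition act on indicators of null sets and on square-integrable
    functions. *)
Definition contractive_weight (w : T2 -> R) (t : T2 -> T1) : Prop :=
  [/\ measurable_fun setT w, measurable_fun setT t &
    forall f : T1 -> \bar R, measurable_fun setT f -> (forall x, 0 <= f x)%E ->
      (\int[mu2]_x ((w x ^+ 2)%:E * f (t x)) <= \int[mu1]_x f x)%E].

Definition isometric_weight (w : T2 -> R) (t : T2 -> T1) : Prop :=
  [/\ measurable_fun setT w, measurable_fun setT t &
    forall f : T1 -> \bar R, measurable_fun setT f -> (forall x, 0 <= f x)%E ->
      (\int[mu2]_x ((w x ^+ 2)%:E * f (t x)) = \int[mu1]_x f x)%E].

Lemma isometric_contractive w t : isometric_weight w t -> contractive_weight w t.
Proof. by move=> [mw mt iw]; split=> // f mf f0; rewrite iw. Qed.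

(** This has the same form as [markov_rep], so that each $S_j$ is an instance by mere unfolding
    ([markov_repE]). *)
Definition wcomp (w : T2 -> R) (t : T2 -> T1) (u : L2 mu1) : L2 mu2 :=
  (\pi_(L2 mu2) (insubd (0 : funL2 mu2)
    (fun x => (w x)%:C%C * evL2 (repr u) (t x))))%qT.

Variables (w : T2 -> R) (t : T2 -> T1).

Section Contractive.
Hypothesis wt : contractive_weight w t.

(** Contractivity applied to the indicator of a null set [A] outside which [P] holds shows that [w]
    vanishes almost everywhere on the preimage of [A]. Where [w] vanishes nothing is known about
    [t], hence the guard in the conclusion. *)
Lemma ae_contractive (P : T1 -> Prop) : {ae mu1, forall x, P x} ->
  {ae mu2, forall x, w x != 0 -> P (t x)}.
Proof.
have [mw mt cw] := wt; move=> [A [mA A0 PA]].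
have mf : measurable_fun setT (fun x => (\1_A x : R)%:E).
  by apply/measurable_EFinP; exact: measurable_indic.
have := cw _ mf; rewrite integral_indic// setIT A0 => /(_ (fun x => _)).
have mg : measurable_fun setT (fun x => ((w x ^+ 2)%:E * (\1_A (t x) : R)%:E)%E).
  apply: emeasurable_funM; first by apply/measurable_EFinP; exact: measurable_funX.
  exact: (measurableT_comp mf mt).
have g0 x : (0 <= (w x ^+ 2)%:E * (\1_A (t x) : R)%:E)%E.
  by rewrite mule_ge0 ?lee_fin ?sqr_ge0.
move=> le0; have /(ae_eq_integral_abs mu2 measurableT mg) : (\int[mu2]_x `|(w x
  ^+ 2)%:E * (\1_A (t x) : R)%:E| = 0)%E.
  under eq_integral do rewrite gee0_abs//.
  by apply/eqP; rewrite eq_le integral_ge0 ?le0.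
apply: filterS => x /(_ I) /= h wx; apply: contrapT => nP.
have Atx : A (t x) by apply: PA.
move: h; rewrite indicE mem_set// mule1 => -[] /eqP.
by rewrite sqrf_eq0 (negbTE wx).
Qed.

Lemma finL2_wcomp (u : L2 mu1) :
  finL2 mu2 (fun x => (w x)%:C%C * evL2 (repr u) (t x)).
Proof.
have [mw mt cw] := wt; have /finL2P[m1 m2 i] := finL2_repr u.
apply/finL2P; split.
- rewrite (_ : (fun x => _) = (fun x => w x * complex.Re (evL2 (repr u) (t x)))).
    by apply: measurable_funM => //; exact: (measurableT_comp m1 mt).
  by apply/funext => x; rewrite mulcE /= mul0r subr0.
- rewrite (_ : (fun x => _) = (fun x => w x * complex.Im (evL2 (repr u) (t x)))).
    by apply: measurable_funM => //; exact: (measurableT_comp m2 mt).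
  by apply/funext => x; rewrite mulcE /= mul0r addr0.
- under eq_integral do rewrite sqmodM EFinM.
  apply: le_lt_trans i; apply: (cw (fun x => (sqmod (evL2 (repr u) x))%:E)).
    by apply: measurable_int (integrable_sqmod u).
  by move=> x; rewrite lee_fin sqmod_ge0.
Qed.

Lemma ae_wcomp (u : L2 mu1) : {ae mu2, forall x,
  evL2 (repr (wcomp w t u)) x = (w x)%:C%C * evL2 (repr u) (t x)}.
Proof. exact/ae_insubd/finL2_wcomp. Qed.

Lemma wcomp_linear : linear (wcomp w t).
Proof.
move=> a u v; apply/eqL2P.
have h123 := ae_and (ae_and (ae_wcomp u) (ae_wcomp v)) (ae_contractive (evL2_lin
  a u v)).
have h45 := ae_and (ae_wcomp (a *: u + v)) (evL2_lin a (wcomp w t u) (wcomp w t v)).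
apply: filterS (ae_and h123 h45) => x [[[h1 h2] h3] [h4 h5]].
rewrite h4 h5 h1 h2.
have [->|wx] := eqVneq (w x) 0; first by rewrite !mul0r mulr0 addr0.
by rewrite h3// mulrDr mulrCA.
Qed.

End Contractive.

(** The isometry condition speaks of nonnegative functions only; it is applied to the positive and
    the negative part of [f], through which the nonnegative factor [w x ^+ 2] passes. *)
Lemma integral_isometric (f : T1 -> R) : isometric_weight w t ->
  mu1.-integrable setT (EFin \o f) ->
  mu2.-integrable setT (EFin \o (fun x => w x ^+ 2 * f (t x))) /\
  \int[mu2]_x (w x ^+ 2 * f (t x)) = \int[mu1]_x f x.
Proof.
move=> [mw mt cw] /integrableP[mf fi].
have mf' : measurable_fun setT (EFin \o (fun x => w x ^+ 2 * f (t x))).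
  apply/measurable_EFinP; apply: measurable_funM; first exact: measurable_funX.
  by apply: measurableT_comp => //; apply/measurable_EFinP.
split.
  apply/integrableP; split => //; rewrite -(cw (fun x => `|(f x)%:E|%E)) in fi =>
    //.
    apply: le_lt_trans fi; rewrite le_eqVlt; apply/orP; left; apply/eqP.
    by apply: eq_integral => x _; rewrite /= normrM ger0_norm ?sqr_ge0.
  exact: measurableT_comp.
rewrite /Rintegral; congr fine; rewrite integralE [RHS]integralE; congr (_ - _)%E.
  rewrite -cw//; last exact: measurable_funepos.
  apply: eq_integral => x _; rewrite !funeposE/= EFinM.
  by rewrite [RHS]maxe_pMr ?mule0//= lee_fin sqr_ge0.
rewrite -cw//; last exact: measurable_funeneg.
apply: eq_integral => x _; rewrite !funenegE/= -mulrN EFinM.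
by rewrite [RHS]maxe_pMr ?mule0//= lee_fin sqr_ge0.
Qed.

End WeightedComposition.

(** * Products and adjoints of weighted compositions *)

Section CompositionRules.
Context {d1 d2 d3 : measure_display} {T1 : measurableType d1}.
Context {T2 : measurableType d2} {T3 : measurableType d3} {R : realType}.
Variables (mu1 : {measure set T1 -> \bar R}) (mu2 : {measure set T2 -> \bar R}).
Variable (mu3 : {measure set T3 -> \bar R}).
Local Notation C := R[i].

(** Agreement of the maps is asked only where the weight is nonzero. This permits comparing [id]
    with [word_cons j \o word_shift], which coincide only on words that begin with [j]. *)
Lemma eq_wcomp (w w' : T2 -> R) (t t' : T2 -> T1) (u : L2 mu1) :
  contractive_weight mu1 mu2 w t -> contractive_weight mu1 mu2 w' t' ->
  {ae mu2, forall x, w x = w' x} -> (forall x, w x != 0 -> t x = t' x) ->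
  wcomp mu2 w t u = wcomp mu2 w' t' u.
Proof.
move=> wt wt' ww' tt'; apply/eqL2P.
apply: filterS (ae_and (ae_and (ae_wcomp wt u) (ae_wcomp wt' u)) ww').
move=> x [[-> ->] <-]; have [->|wx] := eqVneq (w x) 0; first by rewrite !mul0r.
by rewrite tt'.
Qed.

Lemma contractive_comp (w : T2 -> R) (t : T2 -> T1) (v : T3 -> R) (s : T3 -> T2) :
  contractive_weight mu1 mu2 w t -> contractive_weight mu2 mu3 v s ->
  contractive_weight mu1 mu3 (fun x => v x * w (s x)) (t \o s).
Proof.
move=> [mw mt cw] [mv ms cv]; split.
- by apply: measurable_funM => //; exact: measurableT_comp.
- exact: measurableT_comp.
move=> f mf f0; apply: le_trans (cw f mf f0).
have mg : measurable_fun setT (fun x => ((w x ^+ 2)%:E * f (t x))%E).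
  apply: emeasurable_funM; last exact: (measurableT_comp mf mt).
  by apply/measurable_EFinP; exact: measurable_funX.
apply: le_trans (cv _ mg _); last first.
  by move=> x; rewrite mule_ge0// lee_fin sqr_ge0.
rewrite le_eqVlt; apply/orP; left; apply/eqP; apply: eq_integral => x _ /=.
by rewrite exprMn EFinM muleA.
Qed.

Lemma wcomp_comp (w : T2 -> R) (t : T2 -> T1) (v : T3 -> R) (s : T3 -> T2)
    (u : L2 mu1) :
  contractive_weight mu1 mu2 w t -> contractive_weight mu2 mu3 v s ->
  wcomp mu3 v s (wcomp mu2 w t u) = wcomp mu3 (fun x => v x * w (s x)) (t \o s) u.
Proof.
move=> wt vs; apply/eqL2P.
have h1 := ae_wcomp vs (wcomp mu2 w t u).
have h2 := ae_contractive vs (ae_wcomp wt u).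
have h3 := ae_wcomp (contractive_comp wt vs) u.
apply: filterS (ae_and (ae_and h1 h2) h3) => x [[-> h] ->].
have [->|vx] := eqVneq (v x) 0; first by rewrite !mul0r.
by rewrite h// mulrA rmorphM.
Qed.

Lemma contractive_bounded (w : T1 -> R) : measurable_fun setT w ->
  (forall x, `|w x| <= 1) -> contractive_weight mu1 mu1 w id.
Proof.
move=> mw w1; split=> // f mf f0; apply: ge0_le_integral => //.
- by move=> x _; rewrite mule_ge0// lee_fin sqr_ge0.
- by apply: emeasurable_funM => //; apply/measurable_EFinP; exact: measurable_funX.
move=> x _; rewrite -[leRHS]mul1e; apply: lee_wpmul2r => //.
by rewrite lee_fin -real_normK ?num_real// expr_le1.
Qed.

Lemma wcomp1 (u : L2 mu1) : wcomp mu1 (cst 1) id u = u.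
Proof.
have c1 : contractive_weight mu1 mu1 (cst 1) id.
  by apply: contractive_bounded => // x; rewrite normr1.
by apply/eqL2P; apply: filterS (ae_wcomp c1 u) => x ->; rewrite mul1r.
Qed.

(* The weight [v] inverts [w] along the graph of [t], where [w] does not vanish;
   then [v, s] gives the adjoint of the isometry given by [w, t]. *)
Definition weight_inverse (w : T2 -> R) (t : T2 -> T1) (v : T1 -> R)
    (s : T1 -> T2) : Prop :=
  forall x, w x != 0 -> w x * v (t x) = 1 /\ s (t x) = x.

(** Pulled back along [t], the integral of $v^2 (f\circ s)$ has integrand $w^2 (v\circ t)^2 (f\circ
    s\circ t)$, which is [f] where [w] is nonzero and 0 elsewhere. The second case is why only an
    inequality results. *)
Lemma contractive_inverse (w : T2 -> R) (t : T2 -> T1) (v : T1 -> R)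
    (s : T1 -> T2) : isometric_weight mu1 mu2 w t -> weight_inverse w t v s ->
  measurable_fun setT v -> measurable_fun setT s ->
  contractive_weight mu2 mu1 v s.
Proof.
move=> [mw mt iw] wv mv ms; split=> // f mf f0.
have mg : measurable_fun setT (fun x => ((v x ^+ 2)%:E * f (s x))%E).
  apply: emeasurable_funM; last exact: (measurableT_comp mf ms).
  by apply/measurable_EFinP; exact: measurable_funX.
have g0 x : (0 <= (v x ^+ 2)%:E * f (s x))%E.
  by rewrite mule_ge0// lee_fin sqr_ge0.
rewrite -iw//; apply: ge0_le_integral => //.
- by move=> x _; rewrite mule_ge0// lee_fin sqr_ge0.
- apply: emeasurable_funM; last exact: (measurableT_comp mg mt).
  by apply/measurable_EFinP; exact: measurable_funX.
move=> x _; have [->|wx] := eqVneq (w x) 0; first by rewrite expr0n mul0e.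
have [h ->] := wv _ wx.
by rewrite muleA -EFinM -exprMn h expr1n mul1e.
Qed.

(** Pulling the right-hand product back to [mu2] produces the factor $w^2$; since $w (v\circ t) = 1$
    where [w] is nonzero, one of the two factors [w] cancels against the weight of the adjoint. *)
Lemma dot_wcomp_adjoint (w : T2 -> R) (t : T2 -> T1) (v : T1 -> R)
    (s : T1 -> T2) (f : L2 mu1) (g : L2 mu2) :
  isometric_weight mu1 mu2 w t -> weight_inverse w t v s ->
  measurable_fun setT v -> measurable_fun setT s ->
  dotL2 mu2 (wcomp mu2 w t f) g = dotL2 mu1 f (wcomp mu1 v s g).
Proof.
move=> iw wv mv ms; have cv := contractive_inverse iw wv mv ms.
have cw := isometric_contractive iw.
set k := wcomp mu1 v s g.
have [k1 k2] := Cintegrable_mulL2 (repr f) (repr k).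
have [i1 e1] := integral_isometric iw k1.
have [i2 e2] := integral_isometric iw k2.
pose h := fun x => (w x ^+ 2)%:C%C *
  (evL2 (repr f) (t x) * Num.conj (evL2 (repr k) (t x))).
have hE : h = fun x => Complex
   (w x ^+ 2 * complex.Re (evL2 (repr f) (t x) * Num.conj (evL2 (repr k) (t x))))
   (w x ^+ 2 * complex.Im (evL2 (repr f) (t x) * Num.conj (evL2 (repr k) (t x)))).
  by apply/funext => x; rewrite /h [LHS]mulcE /= !mul0r subr0 addr0.
rewrite [RHS]/dotL2 [RHS]/Cintegral -[X in Complex X _]e1 -[X in Complex _ X]e2.
transitivity (Cintegral mu2 h); last by rewrite hE.
apply: ae_eq_Cintegral; first exact: Cintegrable_mulL2.
  by rewrite hE; split.
have h3 := ae_contractive cw (ae_wcomp cv g).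
apply: filterS (ae_and (ae_wcomp cw f) h3) => x [-> kx].
rewrite /h; have [->|wx] := eqVneq (w x) 0.
  by rewrite expr0n !mul0r.
have [wv1 stx] := wv _ wx; rewrite kx// stx.
rewrite [Num.conj (_ * _)]rmorphM /= (_ : Num.conj (v (t x))%:C%C = (v (t
  x))%:C%C); last first.
  by rewrite conjcE /= oppr0.
have -> : (w x ^+ 2)%:C%C = (w x)%:C%C * (w x)%:C%C :> C by rewrite expr2 rmorphM.
have E : (w x)%:C%C * (v (t x))%:C%C = 1 :> C by rewrite -rmorphM wv1.
(* A factor 1 is inserted on the left and expanded by [E], after which the two sides agree as
   polynomials. *)
by rewrite -[LHS]mulr1 -[in LHS]E; ring.
Qed.

Lemma dot_wcomp_isometry (w : T2 -> R) (t : T2 -> T1) (f g : L2 mu1) :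
  isometric_weight mu1 mu2 w t ->
  dotL2 mu2 (wcomp mu2 w t f) (wcomp mu2 w t g) = dotL2 mu1 f g.
Proof.
move=> iw; have cw := isometric_contractive iw.
have [k1 k2] := Cintegrable_mulL2 (repr f) (repr g).
have [i1 e1] := integral_isometric iw k1.
have [i2 e2] := integral_isometric iw k2.
pose h := fun x => (w x ^+ 2)%:C%C *
  (evL2 (repr f) (t x) * Num.conj (evL2 (repr g) (t x))).
have hE : h = fun x => Complex
   (w x ^+ 2 * complex.Re (evL2 (repr f) (t x) * Num.conj (evL2 (repr g) (t x))))
   (w x ^+ 2 * complex.Im (evL2 (repr f) (t x) * Num.conj (evL2 (repr g) (t x)))).
  by apply/funext => x; rewrite /h [LHS]mulcE /= !mul0r subr0 addr0.
rewrite [RHS]/dotL2 [RHS]/Cintegral -[X in Complex X _]e1 -[X in Complex _ X]e2.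
transitivity (Cintegral mu2 h); last by rewrite hE.
apply: ae_eq_Cintegral; first exact: Cintegrable_mulL2.
  by rewrite hE; split.
apply: filterS (ae_and (ae_wcomp cw f) (ae_wcomp cw g)) => x [-> ->].
rewrite /h [Num.conj (_ * _)]rmorphM /= (_ : Num.conj (w x)%:C%C = (w x)%:C%C);
  last first.
  by rewrite conjcE /= oppr0.
by rewrite expr2 rmorphM /=; ring.
Qed.

End CompositionRules.

(** Two adjoints of [A] differ at [v] by a vector orthogonal to everything, hence to itself; by
    definiteness the choice made by [xget] can only be [B]. *)
Lemma adjointE {R : realType} {U : lmodType R[i]} (dot : {dot U for Num.conj})
    (A B : U -> U) : (forall u v, dot (A u) v = dot u (B v)) -> adjoint dot A = B.
Proof.
move=> AB; rewrite /adjoint; case: xgetP => [B' _ /= AB'|/(_ B)//].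
apply/funext => v; apply/eqP; rewrite -subr_eq0; apply/negP => /negP h.
have : 0 < dot (B' v - B v) (B' v - B v) by exact: neq0_dnorm_gt0.
rewrite linearBr /=.
by rewrite -AB -AB' subrr ltxx.
Qed.

(** * Sets and functions of finitely many letters *)

Section PrefixSet.
Context {n : nat}.
Local Notation N := n.+2.
Local Notation K := (words n).

Definition prefix_set (m : nat) (P : pred (seq 'I_N)) : set K :=
  [set x : K | P (mkseq x m)].

Definition prefix_sets : set (set K) := [set A | exists m P, A = prefix_set m P].

(** Otherwise each prefix of [x] extends to some [y m] outside [U]. Coordinate [i] of [y m] equals
    that of [x] as soon as [m] exceeds [i], so [y m] tends to [x] in the product topology and must
    enter [U]. *)
Lemma open_prefix (U : set K) (x : K) : open U -> U x ->
  exists m, forall y : K, mkseq y m = mkseq x m -> U y.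
Proof.
move=> oU Ux; apply: contrapT => /forallNP h.
have {}h m : exists y : K, mkseq y m = mkseq x m /\ ~ U y.
  by apply: contrapT => /forallNP h'; apply: (h m) => y yx;
    apply: contrapT => Uy; apply: (h' y).
have [y hy] := choice h.
have : y m @[m --> \oo] --> (x : K).
  apply/cvg_sup => i A; rewrite nbhsE => -[B [[C oC <-] Cx] sBA].
  exists i.+1 => // m /= im; apply: sBA => /=.
  have /(congr1 (fun s => nth ord0 s i)) := (hy m).1.
  by rewrite !nth_mkseq// => ->.
move=> /(_ U); rewrite nbhs_simpl /=.
have Un : nbhs (x : K) U by apply: open_nbhs_nbhs.
move=> /(_ Un) [m _ /(_ m (leqnn m))] /=.
exact: (hy m).2.
Qed.

Lemma prefix_setT : setT = prefix_set 0 xpredT.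
Proof. by apply/seteqP; split. Qed.

Lemma prefix_setC m P : ~` (prefix_set m P) = prefix_set m (predC P).
Proof. by apply/seteqP; split => x; rewrite /prefix_set /= => /negP. Qed.

Lemma take_mkseq (x : K) m l : (m <= l)%N -> take m (mkseq x l) = mkseq x m.
Proof. by move=> ml; rewrite -map_take take_iota (minn_idPl ml). Qed.

Lemma prefix_set_widen m l P : (m <= l)%N ->
  prefix_set m P = prefix_set l (fun I => P (take m I)).
Proof. by move=> ml; apply/seteqP; split=> x; rewrite /prefix_set /= take_mkseq.
  Qed.

Lemma prefix_setU m P l Q : prefix_set m P `|` prefix_set l Q =
  prefix_set (maxn m l) (fun I => P (take m I) || Q (take l I)).
Proof.
rewrite (prefix_set_widen P (leq_maxl m l)) (prefix_set_widen Q (leq_maxr m l)).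
by apply/seteqP; split=> x; rewrite /prefix_set /=; [case=> ->;
  rewrite ?orbT|case/orP; [left|right]].
Qed.

Lemma prefix_sets_setI : setI_closed prefix_sets.
Proof.
move=> _ _ [m [P ->]] [l [Q ->]]; rewrite -[_ `&` _]setCK setCI !prefix_setC
  prefix_setU.
by rewrite prefix_setC; do 2 eexists.
Qed.

Lemma open_coord k (a : 'I_N) : open [set x : K | x k = a].
Proof.
have -> : [set x : K | x k = a] = (fun x : K => x k) @^-1` [set a] by [].
have /continuousP : continuous (fun x : K => x k : discrete_topology 'I_N).
  exact: (@proj_continuous nat (fun=> discrete_topology 'I_N) k).
by apply; exact: discrete_open.
Qed.

Lemma measurable_coord k (a : 'I_N) : measurable [set x : K | x k = a].
Proof. by apply: sub_sigma_algebra; exact: open_coord. Qed.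

Lemma measurable_prefix_set m P : measurable (prefix_set m P).
Proof.
elim: m P => [|m IH] P.
  have [P0|P0] := boolP (P [::]).
    by rewrite (_ : prefix_set 0 P = setT)//; apply/seteqP; split.
  rewrite (_ : prefix_set 0 P = set0)//; apply/seteqP; split => x //=.
  by rewrite /prefix_set /= (negbTE P0).
have -> : prefix_set m.+1 P = \big[setU/set0]_(a : 'I_N)
   (prefix_set m (fun I => P (rcons I a)) `&` [set x : K | x m = a]).
  apply/seteqP; split => x; rewrite -bigcup_seq /=.
    by rewrite /prefix_set /= mkseqS => Px; exists (x m) => //=;
      rewrite mem_index_enum.
  by case=> a _ [] /=; rewrite /prefix_set /= mkseqS => h ->.
apply: bigsetU_measurable => a _; apply: measurableI; first exact: IH.
exact: measurable_coord.
Qed.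

(** An open set is a countable union of prefix sets: for each [m], take the words of length [m] all
    of whose extensions lie in it. *)
Lemma measurable_wordsE : @measurable _ K = <<s prefix_sets >>.
Proof.
apply/seteqP; split.
  apply: smallest_sub; first exact: smallest_sigma_algebra.
  move=> U oU.
  have -> : U = \bigcup_m prefix_set m
      (fun I => `[< forall y : K, mkseq y m = I -> U y >]).
    apply/seteqP; split=> [x Ux|x [m _ /= /asboolP]]; last exact.
    by have [m h] := open_prefix oU Ux; exists m => //=; apply/asboolP.
  apply: sigma_algebra_bigcup => m; apply: sub_sigma_algebra.
  by do 2 eexists.
apply: smallest_sub; first exact: sigma_algebra_measurable.
by move=> _ [m [P ->]]; exact: measurable_prefix_set.
Qed.

Lemma measurable_words_map {d} {T : measurableType d} (f : T -> K) :
  (forall k a, measurable [set x | f x k = a]) -> measurable_fun setT f.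
Proof.
move=> mf; apply: (measurability prefix_sets); first exact: measurable_wordsE.
move=> _ [_ [m [P ->]] <-]; rewrite setTI.
elim: m P => [|m IH] P.
  have [P0|P0] := boolP (P [::]).
    by rewrite (_ : _ @^-1` _ = setT)//; apply/seteqP; split.
  rewrite (_ : _ @^-1` _ = set0)//; apply/seteqP; split => x //=.
  by rewrite /prefix_set /= (negbTE P0).
have -> : f @^-1` prefix_set m.+1 P = \big[setU/set0]_(a : 'I_N)
   ((f @^-1` prefix_set m (fun I => P (rcons I a))) `&` [set x | f x m = a]).
  apply/seteqP; split => x; rewrite -bigcup_seq /=.
    by rewrite /prefix_set /= mkseqS => Px; exists (f x m) => //=;
      rewrite mem_index_enum.
  by case=> a _ [] /=; rewrite /prefix_set /= mkseqS => h ->.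
apply: bigsetU_measurable => a _; apply: measurableI; first exact: IH.
exact: mf.
Qed.

Lemma measurable_prefix_fun {R : realType} m (g : seq 'I_N -> R) :
  measurable_fun setT (fun x : K => g (mkseq x m)).
Proof.
move=> _ B mB; rewrite setTI.
have -> : (fun x : K => g (mkseq x m)) @^-1` B = prefix_set m (fun I => `[< B (g
  I) >]).
  by apply/seteqP; split=> x /= /asboolP.
exact: measurable_prefix_set.
Qed.

Lemma measurable_word_shift : measurable_fun setT (@word_shift n).
Proof. by apply: measurable_words_map => k a; exact: measurable_coord. Qed.

Definition word_cons (j : 'I_N) (x : K) : K := fun k => if k is l.+1 then x l
  else j.

Lemma word_shiftK (x : K) : word_cons (x 0%N) (word_shift x) = x.
Proof. by apply/funext => -[]. Qed.

Lemma measurable_word_cons j : measurable_fun setT (word_cons j).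
Proof.
apply: measurable_words_map => -[|k] a; last exact: measurable_coord.
have [->|ja] := eqVneq j a.
  by rewrite (_ : [set _ | _] = setT)//; apply/seteqP; split.
rewrite (_ : [set _ | _] = set0)//; apply/seteqP; split => // x /= /eqP.
by rewrite (negbTE ja).
Qed.

End PrefixSet.

(** * Approximation of Borel sets by prefix sets, and a criterion for absolute continuity *)

Section PrefixSetMeasure.
Context {n : nat} {R : realType}.
Local Notation N := n.+2.
Local Notation K := (words n).
Local Open Scope ereal_scope.

Lemma cylinderE (I : seq 'I_N) : cylinder I = prefix_set (size I) (pred1 I).
Proof. by apply/seteqP; split => x; rewrite /prefix_set /cylinder /= => /eqP. Qed.

Lemma measure_prefix_set (mu : {measure set K -> \bar R}) m (P : pred (seq 'I_N)) :
  mu (prefix_set m P) = \sum_(I : m.-tuple 'I_N | P I) mu (cylinder I).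
Proof.
rewrite -big_filter; set r := [seq _ <- _ | _].
have rE I : (I \in r) = P I by rewrite mem_filter mem_index_enum andbT.
rewrite fsbig_seq; last exact/filter_uniq/index_enum_uniq.
rewrite -measure_fin_bigcup//; last 2 first.
- apply/trivIsetP => I J _ _ IJ; apply/seteqP; split => // x [].
  rewrite /cylinder /= !size_tuple => hI hJ.
  have IJ' : I = J by apply: val_inj; rewrite /= -hI.
  by move: IJ; rewrite IJ' eqxx.
- by move=> I _; rewrite cylinderE; exact: measurable_prefix_set.
congr (mu _); apply/seteqP; split => x; rewrite /prefix_set /=.
  move=> Px; exists (Tuple (introT eqP (size_mkseq x m))); first by rewrite /= rE.
  by rewrite /cylinder /= size_mkseq.
by case=> I /=; rewrite rE => PI; rewrite /cylinder /= size_tuple => ->.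
Qed.

Section Approximation.
Variables (nu : {measure set K -> \bar R}) (nufin : nu setT < +oo).

Let approx (A : set K) := forall e : R, (0 < e)%R -> exists m P,
  nu (A `\` prefix_set m P) <= e%:E /\ nu (prefix_set m P `\` A) <= e%:E.

Let approxC A : approx A -> approx (~` A).
Proof.
move=> aA e e0; have [m [P [h1 h2]]] := aA e e0.
exists m, (predC P); rewrite -prefix_setC; rewrite !setDE !setCK in h1 h2 *.
by rewrite setIC h2 setIC.
Qed.

Let approxU A B : measurable A -> measurable B ->
  approx A -> approx B -> approx (A `|` B).
Proof.
move=> mA mB aA aB e e0; have e20 : (0 < e / 2)%R by rewrite divr_gt0.
have [m [P [h1 h2]]] := aA _ e20; have [l [Q [h3 h4]]] := aB _ e20.
have mP := measurable_prefix_set m P; have mQ := measurable_prefix_set l Q.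
exists (maxn m l), (fun I => P (take m I) || Q (take l I)); rewrite -prefix_setU.
split; rewrite (splitr e) EFinD.
- apply: le_trans (leeD h1 h3); apply: (le_trans _ (measureU2 _ _ _)) => //;
  try exact: measurableD.
  apply: le_measure; rewrite ?inE; try by repeat (apply: measurableD || apply:
    measurableU).
  by move=> x [[Ax|Bx] /not_orP[nP nQ]]; [left|right].
- apply: le_trans (leeD h2 h4); apply: (le_trans _ (measureU2 _ _ _)) => //;
  try exact: measurableD.
  apply: le_measure; rewrite ?inE; try by repeat (apply: measurableD || apply:
    measurableU).
  by move=> x [[Ax|Bx] /not_orP[nP nQ]]; [left|right].
Qed.

(** The sets with such approximations contain the prefix sets and are closed under complements and
    finite unions. For a countable disjoint union, the part outside the first [k] sets has small
    measure for large [k], as [nu] is finite. Hence they form a Dynkin system containing a pi-system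
    that generates the Borel sets. *)
Lemma prefix_set_approx (A : set K) (e : R) : measurable A -> (0 < e)%R ->
  exists m P, nu (A `\` prefix_set m P) <= e%:E /\ nu (prefix_set m P `\` A) <=
    e%:E.
Proof.
move=> mA; move: e; rewrite -/(approx A); move: mA; rewrite measurable_wordsE.
apply: dynkin_induction.
- exact: measurable_wordsE.
- exact: prefix_sets_setI.
- move=> e e0; exists 0%N, xpredT; rewrite -prefix_setT setDv measure0.
  by split; rewrite lee_fin ltW.
- move=> _ [m [P ->]] e e0; exists m, P; rewrite setDv measure0.
  by split; rewrite lee_fin ltW.
- by move=> S _; exact: approxC.
move=> F mF _ aF e e0; have e20 : (0 < e / 2)%R by rewrite divr_gt0.
pose G k := \big[setU/set0]_(i < k) F i.
have mG k : measurable (G k) by apply: bigsetU_measurable.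
have aG k : approx (G k).
  elim: k => [|k IH].
    rewrite /G big_ord0 -setCT; apply: approxC => d d0.
    exists 0%N, xpredT; rewrite -prefix_setT setDv measure0.
    by split; rewrite lee_fin ltW.
  rewrite /G big_ord_recr /=; apply: approxU => //; exact: mG.
have mU : measurable (\bigcup_k F k) by exact: bigcupT_measurable.
pose H k := (\bigcup_k F k) `\` G k.
have H0 : \bigcap_k H k = set0.
  apply/seteqP; split => // x Hx; have [[k _ Fx] _] := Hx 0%N I.
  have [_] := Hx k.+1 I; apply; rewrite /G -bigcup_mkord; exists k => //=.
have cH : nu (H k) @[k --> \oo] --> 0.
  rewrite -(measure0 nu) -H0; apply: nonincreasing_cvg_mu.
  - apply: le_lt_trans nufin; apply: le_measure; rewrite ?inE//.
    exact: measurableD.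
  - by move=> k; exact: measurableD.
  - by rewrite H0.
  - move=> k l kl; apply/subsetPset; apply: setDS; exact: subset_bigsetU.
have [k hk] : exists k, nu (H k) <= (e / 2)%:E.
  have /(_ [set x | x <= (e / 2)%:E]) := cH.
  have h : nbhs (0 : \bar R) [set x : \bar R | x <= (e / 2)%:E].
    exists (e / 2)%R => //= x /=; rewrite sub0r normrN => xe.
    by rewrite lee_fin ltW// (le_lt_trans (ler_norm _)).
  by rewrite nbhs_simpl /= => /(_ h) [k _ /(_ k (leqnn k))] /= ?; exists k.
have [m [P [h1 h2]]] := aG k _ e20; have mP := measurable_prefix_set m P.
exists m, P; split.
  rewrite (splitr e) EFinD; apply: le_trans (leeD hk h1).
  apply: (le_trans _ (measureU2 _ _ _)) => //; try exact: measurableD.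
  apply: le_measure; rewrite ?inE; try by repeat (apply: measurableD || apply:
    measurableU).
  move=> x [Fx nP]; have [Gx|Gx] := pselect (G k x); first by right.
  by left.
apply: le_trans (le_trans h2 _); last by rewrite lee_fin; lra.
apply: le_measure; rewrite ?inE; try exact: measurableD.
by apply: setDS; rewrite /G -bigcup_mkord => x [i _ Fx]; exists i.
Qed.

End Approximation.

(* Every Borel set is approximated by prefix sets for [nu1] and [nu2] at once. *)
Lemma null_dominates_prefix_set (nu1 nu2 : {measure set K -> \bar R}) :
  nu1 setT < +oo -> nu2 setT < +oo ->
  (forall e : R, (0 < e)%R -> exists2 d : R, (0 < d)%R & forall m P,
     nu2 (prefix_set m P) <= d%:E -> nu1 (prefix_set m P) <= e%:E) ->
  nu1 `<< nu2.
Proof.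
move=> fin1 fin2 h; apply/null_content_dominatesP => A mA nu2A.
apply/eqP; rewrite -measure_le0; apply/lee_addgt0Pr => e e0; rewrite add0e.
have e20 : (0 < e / 2)%R by rewrite divr_gt0.
have [d d0 hd] := h _ e20.
pose nu := measure_add nu1 nu2.
have nuE B : nu B = nu1 B + nu2 B by exact: measure_addE.
have nufin : nu setT < +oo by rewrite nuE lte_add_pinfty.
(* The tolerance [d] controls the [nu2]-measure of the prefix set, because [A] is [nu2]-null; the
   tolerance [e / 2] controls the part of [A] that the prefix set misses under [nu1]. *)
have [|m [P [h1 h2]]] := @prefix_set_approx nu nufin A (Order.min d (e / 2)%R) mA.
  by rewrite lt_min d0 e20.
have mP := measurable_prefix_set m P.
have k2 : nu2 (prefix_set m P) <= d%:E.
  apply: (@le_trans _ _ (nu2 A + nu2 (prefix_set m P `\` A))).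
    apply: (le_trans _ (measureU2 _ _ _)) => //; last exact: measurableD.
    apply: le_measure; rewrite ?inE//; first by apply: measurableU => //;
      exact: measurableD.
    by move=> x Px; have [Ax|Ax] := pselect (A x); [left|right].
  rewrite nu2A add0e; apply: (@le_trans _ _ (nu (prefix_set m P `\` A))).
    by rewrite nuE leeDr.
  by apply: le_trans h2 _; rewrite lee_fin ge_min lexx.
apply: (@le_trans _ _ (nu1 (prefix_set m P) + nu1 (A `\` prefix_set m P))).
  apply: (le_trans _ (measureU2 _ _ _)) => //; last exact: measurableD.
  apply: le_measure; rewrite ?inE//; first by apply: measurableU => //;
    exact: measurableD.
  by move=> x Ax; have [Px|Px] := pselect (prefix_set m P x); [left|right].
rewrite (splitr e) EFinD; apply: leeD; first exact: hd.
apply: (@le_trans _ _ (nu (A `\` prefix_set m P))); first by rewrite nuE leeDl.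
by apply: le_trans h1 _; rewrite lee_fin ge_min lexx orbT.
Qed.

End PrefixSetMeasure.

(** * Equivalence or singularity of Markov measures *)

Section PathSums.
Context {R : realType} {n : nat}.
Local Notation N := n.+2.
Implicit Types (A T : nat -> 'M[R]_N) (i j : 'I_N).

Lemma big_tupleS (V : nmodType) m (f : seq 'I_N -> V) :
  \sum_(I : m.+1.-tuple 'I_N) f I = \sum_i \sum_(J : m.-tuple 'I_N) f (i :: J).
Proof.
rewrite pair_bigA /=.
rewrite (reindex (fun p : 'I_N * m.-tuple 'I_N => [tuple of p.1 :: p.2])) //=.
exists (fun I : m.+1.-tuple 'I_N => (thead I,
  [tuple of behead I])) => [[a J] _|I _].
  by congr pair; apply: val_inj.
by rewrite /= -tuple_eta.
Qed.

Lemma big_tuple0 (V : nmodType) (f : seq 'I_N -> V) :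
  \sum_(I : 0.-tuple 'I_N) f I = f [::].
Proof.
rewrite (bigD1 [tuple]) //= big1 ?addr0// => I /eqP[].
exact: tuple0.
Qed.

(** This is the sum of row [i] of the matrix product $A_k A_{k+1}\cdots A_{k+m-1}$. *)
Definition path_sum A m k i : R := \sum_(J : m.-tuple 'I_N) path_weight A k i J.

Lemma path_sum0 A k i : path_sum A 0 k i = 1.
Proof. by rewrite /path_sum (big_tuple0 (path_weight A k i)). Qed.

Lemma path_sumS A m k i :
  path_sum A m.+1 k i = \sum_j A k i j * path_sum A m k.+1 j.
Proof.
rewrite /path_sum (big_tupleS _ (path_weight A k i)); apply: eq_bigr => j _ /=.
by rewrite mulr_sumr.
Qed.

Lemma path_weight_gt0 A : (forall k i j, 0 < A k i j) ->
  forall I k i, 0 < path_weight A k i I.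
Proof. by move=> A0; elim=> //= j I IH k i; rewrite mulr_gt0. Qed.

(** Each step costs a factor of at most $1 + c \le e^{c}$. *)
Lemma path_sum_le A (c : nat -> R) : (forall k i j, 0 <= A k i j) ->
  (forall k, 0 <= c k) -> (forall k i, \sum_j A k i j <= 1 + c k) ->
  forall m k i, path_sum A m k i <= expR (\sum_(l < m) c (k + l)%N).
Proof.
move=> A0 c0 Ac; elim=> [|m IH] k i; first by rewrite path_sum0 big_ord0 expR0.
rewrite path_sumS [in leRHS]big_ord_recl /= addn0 expRD.
under [X in _ <= _ * expR X]eq_bigr do rewrite /bump /= add1n addnS -addSn.
apply: (@le_trans _ _ (\sum_j A k i j * expR (\sum_(l < m) c (k.+1 + l)%N))).
  by apply: ler_sum => j _; apply: ler_wpM2l.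
rewrite -mulr_suml; apply: ler_wpM2r; first exact: expR_ge0.
exact: le_trans (Ac k i) (expR_ge1Dx _).
Qed.

(* Every row is reached from every row with weight at least [d], so two steps
   see all the row defects of the second matrix. *)
Lemma path_sum_decay A (d : R) : 0 <= d -> (forall k i j, d <= A k i j) ->
  (forall k i, \sum_j A k i j <= 1) ->
  forall m k i, path_sum A m.*2 k i <=
    expR (- d * \sum_(l < m) \sum_j (1 - \sum_i A (k + l.*2.+1)%N j i)).
Proof.
move=> d0 dA A1.
have A0 k i j : 0 <= A k i j by exact: le_trans (dA k i j).
elim=> [|m IH] k i; first by rewrite path_sum0 big_ord0 mulr0 expR0.
rewrite doubleS path_sumS [X in expR (_ * X)]big_ord_recl mulrDr expRD.
set M := (X in _ * X); have M0 : 0 <= M by exact: expR_ge0.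
have IHM j : path_sum A m.*2 k.+2 j <= M.
  apply: le_trans (IH k.+2 j) _; rewrite le_eqVlt; apply/orP; left; apply/eqP.
  congr (expR (_ * _)); apply: eq_bigr => l _; apply: eq_bigr => a _.
  by rewrite /= /bump /= doubleS !addSn !addnS.
pose r j := 1 - \sum_i A (k + 1)%N j i.
have r0 j : 0 <= r j by rewrite subr_ge0.
apply: (@le_trans _ _ (\sum_j A k i j * ((1 - r j) * M))).
  apply: ler_sum => j _; apply: ler_wpM2l => //; rewrite path_sumS.
  rewrite /r opprB addrC subrK mulr_suml addn1.
  by apply: ler_sum => a _; apply: ler_wpM2l.
(* There remains the two-step factor: $\sum_j A_{ij}(1-r_j) \le 1 - d\sum_j r_j \le \exp(-d\sum_j
   r_j)$. *)
under eq_bigr do rewrite mulrA; rewrite -mulr_suml; apply: ler_wpM2r => //.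
apply: le_trans (expR_ge1Dx _).
have -> : \sum_j A k i j * (1 - r j) = \sum_j A k i j - \sum_j A k i j * r j.
  by rewrite -sumrB; apply: eq_bigr => j _; rewrite mulrBr mulr1.
rewrite mulNr; apply: lerB => //; rewrite mulr_sumr; apply: ler_sum => j _.
by apply: ler_wpM2r; [exact: r0|exact: dA].
Qed.

End PathSums.

(** * Uniform consequences of quasi-stationarity *)

Section UniformBounds.
Context {R : realType} {n : nat}.
Local Notation N := n.+2.
Variables (lam : 'rV[R]_N) (T : nat -> 'M[R]_N).
Hypotheses (lamT : markov_data lam T) (qT : quasi_stationary T).

Let T_gt0 k i j : 0 < T k i j. Proof. by case: lamT. Qed.

Lemma step_ratio_gt0 k (x : words n) : 0 < step_ratio T k x.
Proof. by rewrite divr_gt0. Qed.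

Lemma quasi_stationary_bound (x : words n) :
  exists B : R, forall m, \sum_(k < m) `|step_ratio T k x - 1| <= B.
Proof.
pose S := (\sum_(0 <= k <oo) `|step_ratio T k x - 1|%:E)%E.
have S0 : (0 <= S)%E by apply: nneseries_ge0 => k _ _; rewrite lee_fin.
exists (fine S) => m; rewrite -lee_fin fineK; last by rewrite ge0_fin_numE//;
  exact: qT.
rewrite -sumEFin -(big_mkord xpredT (fun k => `|step_ratio T k x - 1|%:E)).
by apply: nneseries_lim_ge => k _; rewrite lee_fin.
Qed.

(** At every position one of the words $ijij\dots$ and $jiji\dots$ makes the transition from [i] to
    [j], so their two series together dominate the series of the entry [(i, j)]. *)
Lemma transition_ratio_bound : exists B : R, forall m i j,
  \sum_(k < m) `|T k i j / T k.+1 i j - 1| <= B.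
Proof.
have pw p : exists B : R, forall m, \sum_(k < m) `|T k p.1 p.2 / T k.+1 p.1 p.2 -
  1| <= B.
  case: p => i j /=.
  pose x : words n := fun k => if odd k then j else i.
  pose y : words n := fun k => if odd k then i else j.
  have [B1 h1] := quasi_stationary_bound x; have [B2 h2] :=
    quasi_stationary_bound y.
  exists (B1 + B2) => m; apply: le_trans (lerD (h1 m) (h2 m)).
  rewrite -big_split; apply: ler_sum => k _ /=; rewrite /step_ratio /x /y /=.
  by case: (odd k) => /=; rewrite ?lerDr ?lerDl.
have [B hB] := choice pw.
have B0 p : 0 <= B p by have := hB p 0%N; rewrite big_ord0.
exists (\sum_p B p) => m i j; apply: le_trans (hB (i, j) m) _.
by rewrite (bigD1 (i, j)) //= lerDl sumr_ge0.
Qed.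

(** Summing over all entries of the matrices gives a majorant that does not depend on the word,
    whereas quasi-stationarity is a statement about each word separately. *)
Lemma step_ratio_summable : exists a : nat -> R,
  [/\ forall k (x : words n), `|step_ratio T k x - 1| <= a k,
      forall k, 0 <= a k & exists B, forall m, \sum_(k < m) a k <= B].
Proof.
have [B hB] := transition_ratio_bound.
exists (fun k => \sum_i \sum_j `|T k i j / T k.+1 i j - 1|); split.
- move=> k x; rewrite (bigD1 (x k)) //= (bigD1 (x k.+1)) //= -addrA lerDl.
  by rewrite addr_ge0// ?sumr_ge0// => i _; rewrite sumr_ge0.
- by move=> k; rewrite sumr_ge0// => i _; rewrite sumr_ge0.
exists (\sum_(i : 'I_N) \sum_(j : 'I_N) B) => m.
rewrite exchange_big; apply: ler_sum => i _.
by rewrite exchange_big; apply: ler_sum => j _; exact: hB.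
Qed.

Lemma prod_le_expR (r : nat -> R) m : (forall k, 0 <= r k) ->
  \prod_(k < m) r k <= expR (\sum_(k < m) `|r k - 1|).
Proof.
move=> r0; elim: m => [|m IH]; first by rewrite !big_ord0 expR0.
rewrite !big_ord_recr /= expRD; apply: ler_pM => //; first exact: prodr_ge0.
apply: le_trans (expR_ge1Dx _); rewrite -lerBlDl; exact: ler_norm.
Qed.

(** By telescoping, [T 0 i j] is [T k i j] times a product of [k] ratios, and such products are at
    most [expR B]. *)
Lemma transition_lower_bound : exists2 d : R, 0 < d & forall k i j, d <= T k i j.
Proof.
have [B hB] := transition_ratio_bound.
pose d := \big[Num.min/1]_(p : 'I_N * 'I_N) T 0 p.1 p.2.
have d0 : 0 < d by rewrite /d; elim/big_ind: _ => // a b; rewrite lt_min => -> ->.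
exists (d * expR (- B)) => [|k i j]; first by rewrite mulr_gt0// expR_gt0.
rewrite expRN ler_pdivrMr ?expR_gt0//.
have dT : d <= T 0 i j by exact: (@bigmin_le_cond _ _ _ _ (i, j)).
have E : T 0 i j = T k i j * \prod_(l < k) (T l i j / T l.+1 i j).
  elim: k => [|k IH]; first by rewrite big_ord0 mulr1.
  rewrite big_ord_recr /= IH; field; exact: lt0r_neq0.
apply: le_trans dT _; rewrite E; apply: ler_wpM2l; first exact: ltW.
have r0 l : 0 <= T l i j / T l.+1 i j by rewrite ltW// divr_gt0.
apply: (le_trans (prod_le_expR k r0)).
by rewrite ler_expR.
Qed.

End UniformBounds.

Lemma singular_of_separation {d} {X : measurableType d} {R : realType}
    (mu nu : {measure set X -> \bar R}) :
  (forall e : R, 0 < e -> exists A, [/\ measurable A, (mu A <= e%:E)%E &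
     (nu (~` A) <= e%:E)%E]) -> mutually_singular mu nu.
Proof.
move=> h; have p0 k : 0 < 1 / (2 ^ k.+1)%:R :> R by rewrite divr_gt0// ltr0n
  expn_gt0.
have [A hA] := choice (fun k => h _ (p0 k)).
have mA k : measurable (A k) by case: (hA k).
exists (lim_sup_set A); split.
- by apply: bigcapT_measurable => k; exact: bigcup_measurable.
- apply: lim_sup_set_cvg0 => //.
  apply: (@le_lt_trans _ _ (\sum_(k <oo) (1 / (2 ^ k.+1)%:R)%:E)%E).
    by apply: lee_nneseries => // k _; case: (hA k).
  by apply: le_lt_trans (epsilon_trick0 xpredT ler01) _; rewrite ltry.
rewrite /lim_sup_set setC_bigcap.
have mB k : measurable (~` \bigcup_(j in [set j | (k <= j)%N]) A j).
  by apply: measurableC; exact: bigcup_measurable.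
apply/negligibleP; first exact: bigcupT_measurable.
apply: negligible_bigcup => k; apply/negligibleP => //.
apply/eqP; rewrite -measure_le0; apply/lee_addgt0Pr => e e0; rewrite add0e.
have [l _ hl] := near_infty_natSinv_expn_lt (PosNum e0).
pose j := maxn k l; have [_ _ hj] := hA j.
apply: (@le_trans _ _ (nu (~` A j))).
  apply: le_measure; rewrite ?inE//; first exact: measurableC.
  by apply: subsetC; apply: bigcup_sup; rewrite /= leq_maxl.
apply: le_trans hj _; rewrite lee_fin ltW//.
have /= := hl j.+1 (leq_trans (leq_maxr k l) (leqnSn _)).
by rewrite natrX.
Qed.

(** * Second moments and Hellinger affinities on words of finite length *)

Section Dichotomy.
Context {R : realType} {n : nat}.
Local Notation N := n.+2.
Local Notation K := (words n).

Definition markov_weight (lam : 'rV[R]_N) (T : nat -> 'M[R]_N) (I : seq 'I_N) : R :=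
  if I is i :: J then lam ord0 i * path_weight T 0 i J else 1.

(** The squared Frobenius distance of the two matrices at position [k]. *)
Definition transition_dist (T T' : nat -> 'M[R]_N) k : R :=
  \sum_i \sum_j (T k i j - T' k i j) ^+ 2.

Lemma transition_dist_ge0 T T' k : 0 <= transition_dist T T' k.
Proof. by apply: sumr_ge0 => i _; apply: sumr_ge0 => j _; rewrite sqr_ge0. Qed.

Lemma transition_distC T T' k : transition_dist T T' k = transition_dist T' T k.
Proof.
by apply: eq_bigr => i _; apply: eq_bigr => j _; rewrite -sqrrN opprB.
Qed.

Section OneMeasure.
Variables (lam : 'rV[R]_N) (T : nat -> 'M[R]_N) (mu : probability K R).
Hypotheses (lamT : markov_data lam T) (muM : markov_measure lam T mu).

Lemma markov_weight_gt0 I : 0 < markov_weight lam T I.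
Proof.
have [[l0 _] _ T0 _] := lamT.
by case: I => //= i I; rewrite mulr_gt0// path_weight_gt0.
Qed.

Lemma markov_cylinder I : mu (cylinder I) = (markov_weight lam T I)%:E.
Proof.
case: I => [|i I]; last exact: muM.
rewrite (_ : cylinder [::] = setT) ?probability_setT//; exact/seteqP.
Qed.

Lemma markov_prefix_set m P : mu (prefix_set m P) =
  (\sum_(I : m.-tuple 'I_N | P I) markov_weight lam T I)%:E.
Proof.
by rewrite measure_prefix_set -sumEFin; apply: eq_bigr => I _;
  exact: markov_cylinder.
Qed.

End OneMeasure.

Variables (lam lam' : 'rV[R]_N) (T T' : nat -> 'M[R]_N) (mu mu' : probability K R).
Hypotheses (lamT : markov_data lam T) (lamT' : markov_data lam' T').
Hypotheses (muM : markov_measure lam T mu) (muM' : markov_measure lam' T' mu').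

(** Both matrices are multiplicative along paths: path sums of [chi2] give second moments of the
    density of [mu'] with respect to [mu], those of [aff] give Hellinger affinities. *)
Let chi2 k : 'M[R]_N := \matrix_(i, j) (T' k i j ^+ 2 / T k i j).
Let aff k : 'M[R]_N := \matrix_(i, j) Num.sqrt (T k i j * T' k i j).

Lemma path_weight_chi2 I k i :
  path_weight chi2 k i I = path_weight T' k i I ^+ 2 / path_weight T k i I.
Proof.
elim: I k i => [|j I IH] k i /=; first by rewrite expr1n divr1.
by rewrite IH mxE exprMn invfM; ring.
Qed.

Lemma path_weight_aff I k i :
  path_weight aff k i I = Num.sqrt (path_weight T k i I * path_weight T' k i I).
Proof.
have [_ _ T0 _] := lamT; have [_ _ T'0 _] := lamT'.
elim: I k i => [|j I IH] k i /=; first by rewrite mulr1 sqrtr1.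
rewrite IH mxE -sqrtrM; last by rewrite mulr_ge0// ltW.
by congr Num.sqrt; ring.
Qed.

(** Expand $(T-T')^2/T = T'^2/T - 2T' + T$ and use that all rows sum to 1. *)
Lemma chi2_row k i : \sum_j chi2 k i j =
  1 + \sum_j (T k i j - T' k i j) ^+ 2 / T k i j.
Proof.
have [_ T1 T0 _] := lamT; have [_ T'1 _ _] := lamT'.
have E j : chi2 k i j = (T k i j - T' k i j) ^+ 2 / T k i j + (T' k i j *+ 2 - T
  k i j).
  by rewrite mxE; field; exact: lt0r_neq0.
under eq_bigr do rewrite E.
by rewrite big_split /= sumrB sumrMnl T1 T'1 mulr2n addrK addrC.
Qed.

(** With [a] and [b] the square roots of two corresponding entries, the left side is a sum of terms
    $4(a-b)^2$ and the right side one of $(a-b)^2(a+b)^2$, where $a, b \le 1$. *)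
Lemma aff_row k i : 8 * (1 - \sum_j aff k i j) >= \sum_j (T k i j - T' k i j) ^+ 2.
Proof.
have [_ T1 T0 _] := lamT; have [_ T'1 T'0 _] := lamT'.
have le1 (S : nat -> 'M[R]_N) j : (forall i j, 0 < S k i j) ->
    (forall i, \sum_j S k i j = 1) -> S k i j <= 1.
  move=> S0 S1; rewrite -(S1 i) (bigD1 j) //= lerDl sumr_ge0// => a _; exact: ltW.
have -> : 8 * (1 - \sum_j aff k i j) =
    \sum_j (4 * (T k i j + T' k i j) - 8 * aff k i j).
  by rewrite sumrB -!mulr_sumr big_split /= T1 T'1; ring.
apply: ler_sum => j _; rewrite mxE.
have := le1 T j (T0 k) (T1 k); have := le1 T' j (T'0 k) (T'1 k).
rewrite sqrtrM; last exact: ltW.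
have := sqr_sqrtr (ltW (T0 k i j)); have := sqr_sqrtr (ltW (T'0 k i j)).
have := sqrtr_ge0 (T k i j); have := sqrtr_ge0 (T' k i j).
set a := Num.sqrt (T k i j); set b := Num.sqrt (T' k i j).
move=> b0 a0 <- <- b1 a1.
have -> : (a ^+ 2 - b ^+ 2) ^+ 2 = (a - b) ^+ 2 * (a + b) ^+ 2 by ring.
have -> : 4 * (a ^+ 2 + b ^+ 2) - 8 * (a * b) = (a - b) ^+ 2 * 4 by ring.
apply: ler_wpM2l; first exact: sqr_ge0.
have := sqr_ge0 (a - b); nra.
Qed.

(* The second moments of the densities of [mu'] with respect to [mu] on words of
   length [m] are bounded; AM-GM is used in place of the Cauchy-Schwarz
     inequality. *)
Lemma markov_null_dominates (d B : R) : 0 < d -> (forall k i j, d <= T k i j) ->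
  (forall m, \sum_(k < m) transition_dist T T' k <= B) -> mu' `<< mu.
Proof.
move=> d0 dT hB; have [[l0 _] T1 T0 _] := lamT.
pose c k := transition_dist T T' k / d.
have c0 k : 0 <= c k by rewrite divr_ge0 ?transition_dist_ge0// ltW.
have chi0 k i j : 0 <= chi2 k i j by rewrite mxE divr_ge0 ?sqr_ge0// ltW.
have chi1 k i : \sum_j chi2 k i j <= 1 + c k.
  rewrite chi2_row lerD2l.
  apply: (@le_trans _ _ ((\sum_j (T k i j - T' k i j) ^+ 2) / d)).
    rewrite mulr_suml; apply: ler_sum => j _; apply: ler_wpM2l;
      first exact: sqr_ge0.
    by rewrite lef_pV2 ?posrE.
  apply: ler_wpM2r; first by rewrite invr_ge0 ltW.
  rewrite /transition_dist [leRHS](bigD1 i) //= lerDl.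
  by apply: sumr_ge0 => a _; apply: sumr_ge0 => b _; rewrite sqr_ge0.
(* [D] bounds the second moments for all word lengths; the summand 1 makes its positivity
   immediate. *)
pose D := \sum_i lam' ord0 i ^+ 2 / lam ord0 i * expR (B / d) + 1.
have D0 : 0 < D.
  apply: ltr_wpDl => //; apply: sumr_ge0 => i _.
  by rewrite mulr_ge0 ?expR_ge0// divr_ge0 ?sqr_ge0// ltW.
have hD m : \sum_(I : m.+1.-tuple 'I_N)
    markov_weight lam' T' I ^+ 2 / markov_weight lam T I <= D.
  rewrite (big_tupleS m (fun I => markov_weight lam' T' I ^+ 2 / markov_weight
    lam T I)) /=.
  apply: ler_wpDr => //; apply: ler_sum => i _.
  under eq_bigr => J _.
    rewrite (_ : _ / _ = lam' ord0 i ^+ 2 / lam ord0 i * path_weight chi2 0 i J);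
      last first.
      by rewrite path_weight_chi2 exprMn invfM; ring.
    over.
  rewrite -mulr_sumr; apply: ler_wpM2l; first by rewrite divr_ge0 ?sqr_ge0// ltW.
  apply: le_trans (path_sum_le chi0 c0 chi1 _ _ _) _; rewrite ler_expR.
  rewrite /c -mulr_suml; apply: ler_wpM2r; [by rewrite invr_ge0 ltW|exact: hB].
have fin (nu : probability K R) : (nu setT < +oo)%E by rewrite probability_setT
  ltry.
apply: null_dominates_prefix_set; [exact: fin|exact: fin|move=> e e0].
(* With this [h] and the threshold [e * h], the AM-GM bound below totals $hD/2 + eh/(2h) = e/2 +
   e/2$. *)
pose h := e / D; have h0 : 0 < h by rewrite divr_gt0.
exists (e * h); first by rewrite mulr_gt0.
(* The moment bound [hD] concerns nonempty words, so the prefix set is regarded as one of length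
   [m.+1]. *)
move=> m P; rewrite (prefix_set_widen P (leqnSn m)).
rewrite -[X in (X <= _ -> _)%E]/(mu _) -[X in (_ -> X <= _)%E]/(mu' _).
rewrite (markov_prefix_set muM) (markov_prefix_set muM') !lee_fin.
have amgm I : markov_weight lam' T' I <= h / 2 *
    (markov_weight lam' T' I ^+ 2 / markov_weight lam T I) + (2 * h)^-1 *
      markov_weight lam T I.
  have := markov_weight_gt0 lamT I; set p := markov_weight lam T I.
  set q := markov_weight lam' T' I => p0.
  rewrite -subr_ge0 (_ : _ - q = (2 * h * p)^-1 * (h * q - p) ^+ 2).
    apply: mulr_ge0; last exact: sqr_ge0.
    by rewrite invr_ge0 ltW//; do 2?apply: mulr_gt0.
  by field; rewrite !lt0r_neq0.
move=> hP.
apply: (@le_trans _ _ (\sum_(I : m.+1.-tuple 'I_N | P (take m I)) (h / 2 *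
    (markov_weight lam' T' I ^+ 2 / markov_weight lam T I) + (2 * h)^-1 *
      markov_weight lam T I))).
  by apply: ler_sum.
rewrite big_split /= -!mulr_sumr.
apply: (@le_trans _ _ (h / 2 * D + (2 * h)^-1 * (e * h))).
  apply: lerD; apply: ler_wpM2l => //.
  - by rewrite ltW// divr_gt0.
  - apply: le_trans (hD m); rewrite [leRHS](bigID (fun I : m.+1.-tuple 'I_N => P
    (take m I))) /=.
    rewrite lerDl; apply: sumr_ge0 => I _.
    by rewrite divr_ge0 ?sqr_ge0// ltW// markov_weight_gt0.
  - by rewrite invr_ge0 ltW// mulr_gt0.
rewrite le_eqVlt; apply/orP; left; apply/eqP; rewrite /h.
by field; rewrite !lt0r_neq0.
Qed.

Let affinity m : R := \sum_(I : m.-tuple 'I_N)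
  Num.sqrt (markov_weight lam T I * markov_weight lam' T' I).

Lemma affinityS m : affinity m.+1 =
  \sum_i Num.sqrt (lam ord0 i * lam' ord0 i) * path_sum aff m 0 i.
Proof.
have [[l0 _] _ _ _] := lamT; have [[l'0 _] _ _ _] := lamT'.
rewrite /affinity (big_tupleS m (fun I =>
  Num.sqrt (markov_weight lam T I * markov_weight lam' T' I))) /=.
apply: eq_bigr => i _; rewrite mulr_sumr; apply: eq_bigr => J _.
rewrite path_weight_aff -sqrtrM; last by rewrite mulr_ge0// ltW.
by congr Num.sqrt; ring.
Qed.

Lemma initial_affinity_le1 : \sum_i Num.sqrt (lam ord0 i * lam' ord0 i) <= 1.
Proof.
have [[l0 l1] _ _ _] := lamT; have [[l'0 l'1] _ _ _] := lamT'.
have -> : 1 = \sum_i (lam ord0 i + lam' ord0 i) / 2.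
  by rewrite -mulr_suml big_split /= l1 l'1; field.
apply: ler_sum => i _; rewrite sqrtrM; last exact: ltW.
rewrite -{2}(sqr_sqrtr (ltW (l0 i))) -{2}(sqr_sqrtr (ltW (l'0 i))).
have := sqr_ge0 (Num.sqrt (lam ord0 i) - Num.sqrt (lam' ord0 i)); nra.
Qed.

Lemma aff_ge0 k i j : 0 <= aff k i j. Proof. by rewrite mxE sqrtr_ge0. Qed.

Lemma aff_row_le1 k i : \sum_j aff k i j <= 1.
Proof.
have := aff_row k i; set s := \sum_j aff k i j.
have : 0 <= \sum_j (T k i j - T' k i j) ^+ 2 by apply: sumr_ge0 => j _;
  exact: sqr_ge0.
lra.
Qed.

(** Starting from position [s], two-step decay sees the defects at the positions [s + l.*2.+1]. For
    [s = true] one more step, from position 0, is put in front; it does no harm since the rows of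
    [aff] sum to at most 1. *)
Lemma path_sum_aff_vanish (d : R) (s : bool) : 0 < d ->
  (forall k i j, d <= T k i j) -> (forall k i j, d <= T' k i j) ->
  ~ (exists B, forall m, \sum_(l < m) transition_dist T T' (s + l.*2.+1)%N <= B) ->
  forall e, 0 < e -> exists m, forall i, path_sum aff m 0 i <= e.
Proof.
move=> d0 dT dT' nB e e0.
have dA k i j : d <= aff k i j.
  rewrite mxE -(ger0_norm (ltW d0)) -sqrtr_sqr; apply: ler_wsqrtr.
  by rewrite expr2; apply: ler_pM => //; exact: ltW.
(* The 8 is the constant of [aff_row], which bounds row defects below by squared distances. *)
have decay m i : path_sum aff m.*2 s i <=
    expR (- (d / 8) * \sum_(l < m) transition_dist T T' (s + l.*2.+1)%N).
  apply: le_trans (path_sum_decay (ltW d0) dA aff_row_le1 m s i) _.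
  rewrite ler_expR !mulNr lerN2 -mulrA; apply: ler_wpM2l; first exact: ltW.
  rewrite mulr_sumr; apply: ler_sum => l _.
  rewrite /transition_dist mulr_sumr; apply: ler_sum => a _.
  have := aff_row (s + l.*2.+1) a; lra.
(* The threshold is the [x] for which $\exp(-(d/8)x) = e$; the unbounded partial sums pass it. *)
have [m hm] : exists m, - ln e / (d / 8) <=
    \sum_(l < m) transition_dist T T' (s + l.*2.+1)%N.
  apply: contrapT => /forallNP h; apply: nB; exists (- ln e / (d / 8)) => m.
  by have /negP := h m; rewrite -ltNge => /ltW.
have {}decay i : path_sum aff m.*2 s i <= e.
  apply: le_trans (decay m i) _; rewrite -[leRHS]lnK ?posrE// ler_expR.
  rewrite mulNr lerNl; move: hm; rewrite ler_pdivrMr; last by rewrite divr_gt0.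
  by rewrite mulrC.
case: s decay {nB hm} => decay; last by exists m.*2.
exists m.*2.+1 => i; rewrite path_sumS.
apply: (@le_trans _ _ (\sum_j aff 0 i j * e)).
  by apply: ler_sum => j _; apply: ler_wpM2l; [exact: aff_ge0|exact: decay].
by rewrite -mulr_suml -[leRHS]mul1r; apply: ler_wpM2r;
  [exact: ltW|exact: aff_row_le1].
Qed.

(** Take the words to which [mu'] gives at least the weight that [mu] gives. On them the weight
    under [mu] is at most the geometric mean of the two weights, off them the weight under [mu']
    is. *)
Lemma affinity_small_separates m (e : R) : affinity m <= e ->
  exists P, (mu (prefix_set m P) <= e%:E)%E /\ (mu' (~` prefix_set m P) <= e%:E)%E.
Proof.
move=> he; pose P I := markov_weight lam T I <= markov_weight lam' T' I.
have w0 := markov_weight_gt0 lamT; have w'0 := markov_weight_gt0 lamT'.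
have sq0 I : 0 <= Num.sqrt (markov_weight lam T I * markov_weight lam' T' I).
  exact: sqrtr_ge0.
exists P; rewrite prefix_setC (markov_prefix_set muM) (markov_prefix_set muM')
  !lee_fin.
split; apply: le_trans he; rewrite /affinity.
- rewrite [leRHS](bigID (fun I : m.-tuple 'I_N => P I)) /=.
  apply: ler_wpDr; first exact: sumr_ge0.
  apply: ler_sum => I PI; rewrite -[leLHS](ger0_norm (ltW (w0 _))) -sqrtr_sqr.
  by apply: ler_wsqrtr; rewrite expr2; apply: ler_wpM2l; [exact: ltW|exact: PI].
- rewrite [leRHS](bigID (fun I : m.-tuple 'I_N => P I)) /=.
  apply: ler_wpDl; first exact: sumr_ge0.
  apply: ler_sum => I; rewrite /P -ltNge => /ltW PI.
  rewrite -[leLHS](ger0_norm (ltW (w'0 _))) -sqrtr_sqr.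
  by apply: ler_wsqrtr; rewrite expr2; apply: ler_wpM2r; [exact: ltW|exact: PI].
Qed.

End Dichotomy.


Lemma equivalent_or_singular {R : realType} {n : nat} (lam lam' : 'rV[R]_n.+2)
    (T T' : nat -> 'M[R]_n.+2) (mu mu' : probability (words n) R) :
  markov_data lam T -> markov_data lam' T' ->
  markov_measure lam T mu -> markov_measure lam' T' mu' ->
  quasi_stationary T -> quasi_stationary T' ->
  equivalent_measures mu mu' \/ mutually_singular mu mu'.
Proof.
move=> lamT lamT' muM muM' qT qT'.
have [d1 d10 h1] := transition_lower_bound lamT qT.
have [d2 d20 h2] := transition_lower_bound lamT' qT'.
pose d := Num.min d1 d2; have d0 : 0 < d by rewrite lt_min d10.
have dT k i j : d <= T k i j by apply: le_trans (h1 k i j); rewrite ge_min lexx.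
have dT' k i j : d <= T' k i j by apply: le_trans (h2 k i j);
  rewrite ge_min lexx orbT.
(* [S false] runs through the odd positions and [S true] through the even ones from 2 on; position 0
   is added separately in [SS]. *)
pose S (s : bool) m := \sum_(l < m) transition_dist T T' (s + l.*2.+1)%N.
have [|/existsNP[s nB]] := pselect (forall s, exists B, forall m, S s m <= B).
  move=> hS; left; have [B0 hB0] := hS false; have [B1 hB1] := hS true.
  have SS m : \sum_(k < m.*2.+1) transition_dist T T' k =
      transition_dist T T' 0 + (S false m + S true m).
    elim: m => [|m IH]; first by rewrite big_ord_recl /S !big_ord0 !addr0.
    rewrite doubleS big_ord_recr big_ord_recr /= IH /S !big_ord_recr /=.
    by rewrite add0n add1n; ring.
  pose B := transition_dist T T' 0 + (B0 + B1).
  have hB m : \sum_(k < m) transition_dist T T' k <= B.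
    apply: (@le_trans _ _ (\sum_(k < m.*2.+1) transition_dist T T' k)).
      rewrite -!(big_mkord xpredT) (@big_cat_nat _ _ _ m 0 m.*2.+1)//=; last first.
        by rewrite -addnn ltnW// ltnS leq_addl.
      by rewrite lerDl sumr_ge0// => k _; exact: transition_dist_ge0.
    by rewrite SS lerD2l; apply: lerD.
  split; last exact: (markov_null_dominates lamT lamT' muM muM' d0 dT hB).
  apply: (markov_null_dominates lamT' lamT muM' muM d0 dT' (B := B)) => m.
  by under eq_bigr do rewrite transition_distC; exact: hB.
right; apply: singular_of_separation => e e0.
have [m hm] := path_sum_aff_vanish lamT lamT' d0 dT dT' nB e0.
have [|P [hP1 hP2]] := @affinity_small_separates _ _ _ _ _ _ _ _ lamT lamT' muM
  muM' m.+1 e.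
  rewrite affinityS//.
  apply: (@le_trans _ _ (\sum_i Num.sqrt (lam ord0 i * lam' ord0 i) * e)).
    by apply: ler_sum => i _; apply: ler_wpM2l; rewrite ?sqrtr_ge0.
  rewrite -mulr_suml -[leRHS]mul1r; apply: ler_wpM2r; first exact: ltW.
  exact: initial_affinity_le1 lamT lamT'.
by exists (prefix_set m.+1 P); split => //; exact: measurable_prefix_set.
Qed.

(** * Change of variables under the shift *)

Section ChangeOfVariables.
Context {d1 d2 : measure_display} {T1 : measurableType d1} {T2 : measurableType d2}.
Context {R : realType}.
Variables (mu1 : {measure set T1 -> \bar R}) (mu2 : {measure set T2 -> \bar R}).
Local Open Scope ereal_scope.
Import HBNNSimple.

(** The hypothesis is the isometry condition for indicators. It passes to simple functions by
    linearity and to nonnegative measurable functions by monotone convergence on both sides. *)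
Lemma isometric_weightP (w : T2 -> R) (t : T2 -> T1) :
  measurable_fun setT w -> measurable_fun setT t ->
  (forall A, measurable A -> \int[mu2]_(x in t @^-1` A) (w x ^+ 2)%:E = mu1 A) ->
  isometric_weight mu1 mu2 w t.
Proof.
move=> mw mt wt; split=> // f mf f0.
have mw2 : measurable_fun setT (fun x => (w x ^+ 2)%:E).
  by apply/measurable_EFinP; exact: measurable_funX.
have mpre A : measurable A -> measurable (t @^-1` A).
  by move=> mA; rewrite -[_ @^-1` _]setTI; exact: mt.
pose h := nnsfun_approx measurableT mf.
have mh k : measurable_fun setT (EFin \o h k) by apply/measurable_EFinP.
have mht k : measurable_fun setT (EFin \o h k \o t) by exact: (measurableT_comp
  (mh k) mt).
have -> : \int[mu1]_x f x = limn (fun k => \int[mu1]_x (EFin \o h k) x).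
  rewrite -monotone_convergence//.
  - by apply: eq_integral => x _; apply/esym/cvg_lim => //;
    exact: cvg_nnsfun_approx.
  - by move=> k x _; rewrite lee_fin.
  - by move=> x _ a b ab; rewrite lee_fin; exact/lefP/nd_nnsfun_approx.
have -> : \int[mu2]_x ((w x ^+ 2)%:E * f (t x)) =
    limn (fun k => \int[mu2]_x ((w x ^+ 2)%:E * (EFin \o h k \o t) x)).
  rewrite -monotone_convergence//.
  - apply: eq_integral => x _; apply/esym/cvg_lim => //.
    by apply: cvgeZl => //; exact: cvg_nnsfun_approx.
  - by move=> k; exact: emeasurable_funM.
  - by move=> k x _; rewrite mule_ge0// lee_fin// sqr_ge0.
  - move=> x _ a b ab; apply: lee_wpmul2l; first by rewrite lee_fin sqr_ge0.
    by rewrite lee_fin; exact/lefP/nd_nnsfun_approx.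
congr (limn _); apply/funext => k.
have m1 r : measurable (h k @^-1` [set r]) by exact: measurable_sfunP.
transitivity (\sum_(r \in range (h k))
    \int[mu2]_x ((w x ^+ 2)%:E * (r * \1_(h k @^-1` [set r]) (t x))%:E)).
  rewrite -ge0_integral_fsum//.
  - apply: eq_integral => x _ /=; rewrite fimfunE -fsumEFin// ge0_mule_fsumr// => r.
    exact: nnfun_muleindic_ge0.
  - move=> r; apply: emeasurable_funM => //; apply/measurable_EFinP.
    apply: measurable_funM => //; apply: (measurableT_comp _ mt).
    exact: measurable_indic.
  - move=> r x _; rewrite mule_ge0//; first by rewrite lee_fin sqr_ge0.
    exact: nnfun_muleindic_ge0.
transitivity (\sum_(r \in range (h k)) \int[mu1]_x (r * \1_(h k @^-1` [set r])
  x)%:E); last first.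
  rewrite -ge0_integral_fsum//.
  - by apply: eq_integral => x _ /=; rewrite fimfunE -fsumEFin.
  - by move=> r; apply/measurable_EFinP; apply: measurable_funM => //;
    exact: measurable_indic.
  - by move=> r x _; exact: nnfun_muleindic_ge0.
apply: eq_fsbigr => r; rewrite inE => -[y _ yr].
have r0 : (0 <= r)%R by rewrite -yr.
under eq_integral do rewrite (EFinM r) muleCA.
under [RHS]eq_integral do rewrite (EFinM r).
rewrite [LHS]ge0_integralZl//; last 2 first.
- apply: emeasurable_funM => //; apply/measurable_EFinP.
  by apply: (measurableT_comp _ mt); exact: measurable_indic.
- by move=> x _; rewrite mule_ge0// lee_fin// sqr_ge0.
rewrite ge0_integralZl//; last by apply/measurable_EFinP; exact: measurable_indic.
congr (_ * _); rewrite integral_indic// setIT -wt//.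
rewrite [RHS]integral_mkcond; apply: eq_integral => x _.
by rewrite epatch_indic.
Qed.

End ChangeOfVariables.

Section PrefixIntegral.
Context {R : realType} {n : nat}.
Local Notation N := n.+2.
Local Notation K := (words n).
Variables (lam : 'rV[R]_N) (T : nat -> 'M[R]_N) (mu : probability K R).
Hypotheses (lamT : markov_data lam T) (muM : markov_measure lam T mu).

Lemma integral_prefix m (g : seq 'I_N -> R) : (forall I, 0 <= g I) ->
  (\int[mu]_x (g (mkseq x m))%:E)%E =
  (\sum_(I : m.-tuple 'I_N) g I * markov_weight lam T I)%:E.
Proof.
move=> g0; have mC (I : m.-tuple 'I_N) : measurable (cylinder I : set K).
  by rewrite cylinderE; exact: measurable_prefix_set.
transitivity (\int[mu]_x (\sum_(I : m.-tuple 'I_N) (g I)%:E * (\1_(cylinder I :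
  set K) x)%:E))%E.
  apply: eq_integral => x _.
  rewrite (bigD1 (Tuple (introT eqP (size_mkseq x m)))) //= big1 ?adde0.
    rewrite indicE mem_set ?mule1// /cylinder /=.
    by rewrite size_mkseq.
  move=> I Ix; rewrite indicE memNset ?mule0// => xI; move: Ix.
  suff -> : I = Tuple (introT eqP (size_mkseq x m)) by rewrite eqxx.
  by apply: val_inj; rewrite /= -xI size_tuple.
rewrite ge0_integral_sum//; last 2 first.
- move=> I; apply: emeasurable_funM => //; apply/measurable_EFinP.
  exact: measurable_indic.
- by move=> I x _; rewrite mule_ge0// lee_fin.
rewrite -sumEFin; apply: eq_bigr => I _.
rewrite ge0_integralZl ?lee_fin//; last by apply/measurable_EFinP;
  exact: measurable_indic.
by rewrite integral_indic// setIT EFinM; congr (_ * _)%E;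
  exact: (markov_cylinder muM).
Qed.

End PrefixIntegral.

(** * Convergence and bounds of the infinite product *)

Section ProductRatio.
Context {R : realType} {n : nat}.
Local Notation N := n.+2.
Local Notation K := (words n).
Variables (lam : 'rV[R]_N) (T : nat -> 'M[R]_N).
Hypotheses (lamT : markov_data lam T) (qT : quasi_stationary T).

Let T_gt0 k i j : 0 < T k i j. Proof. by case: lamT. Qed.

Let ratio_gt0 k (x : K) : 0 < step_ratio T k x. Proof.
  exact: step_ratio_gt0 lamT k x. Qed.

(** The upper bound is $\prod r_k \le \exp\sum|r_k-1|$. The lower bound is the same estimate for the
    reciprocals: $|1/r_k - 1| = |1-r_k|/r_k \le |r_k-1|/d$, because the entries of the matrices lie
    between [d] and 1. *)
Lemma prod_ratio_bounds : exists c C : R, [/\ 0 < c, 0 < C & forall m (x : K),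
  c <= \prod_(k < m) step_ratio T k x <= C].
Proof.
have [a [ha a0 [B hB]]] := step_ratio_summable qT.
have [d d0 dT] := transition_lower_bound lamT qT.
have T1 k i j : T k i j <= 1.
  have [_ S1 _ _] := lamT; rewrite -(S1 k i) (bigD1 j) //= lerDl sumr_ge0// => l _.
  exact: ltW.
have rd k (x : K) : d <= step_ratio T k x.
  rewrite ler_pdivlMr//; apply: le_trans (dT k (x k) (x k.+1)).
  by rewrite -[leRHS]mulr1; apply: ler_wpM2l; [exact: ltW|exact: T1].
exists (expR (- (B / d))), (expR B); split; rewrite ?expR_gt0// => m x.
apply/andP; split; last first.
  apply: (le_trans (prod_le_expR m (fun k => ltW (ratio_gt0 k x)))).
  by rewrite ler_expR; apply: le_trans (hB m); apply: ler_sum => k _; exact: ha.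
rewrite expRN -[leRHS]invrK lef_pV2 ?posrE ?expR_gt0 ?invr_gt0 ?prodr_gt0//.
rewrite -prodfV.
have inv_ge0 k : 0 <= (step_ratio T k x)^-1 by rewrite invr_ge0 ltW.
apply: (le_trans (prod_le_expR m inv_ge0)); rewrite ler_expR.
apply: (@le_trans _ _ (\sum_(k < m) a k / d)); last first.
  by rewrite -mulr_suml; apply: ler_wpM2r; [rewrite invr_ge0 ltW|exact: hB].
apply: ler_sum => k _.
have r0 := lt0r_neq0 (ratio_gt0 k x).
rewrite (_ : _ - 1 = (1 - step_ratio T k x) / step_ratio T k x); last by field.
rewrite normrM normfV distrC (gtr0_norm (ratio_gt0 k x)).
apply: ler_pM; [exact: normr_ge0|exact: inv_ge0|exact: ha|].
by rewrite lef_pV2 ?posrE// (lt_le_trans d0).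
Qed.

(** The increments of the partial products are $P_k(r_k-1)$ with $P_k$ bounded, hence absolutely
    summable. *)
Lemma cvg_prod_ratio (x : K) :
  \prod_(k < m) step_ratio T k x @[m --> \oo] --> prod_ratio T x.
Proof.
have [c [C [c0 C0 hC]]] := prod_ratio_bounds.
have [B hB] := quasi_stationary_bound qT x.
pose P m := \prod_(k < m) step_ratio T k x.
suff : cvgn P by [].
have -> : P = (fun m => series (telescope P) m + P 0%N).
  by apply/funext => m; rewrite telescopeK /= subrK.
apply: is_cvgD; last exact: is_cvg_cst.
apply: normed_cvg; apply: nondecreasing_is_cvgn.
  apply/nondecreasing_seqP => m /=; rewrite !seriesEnat /= big_nat_recr//=.
  by rewrite lerDl.
exists (C * B) => _ [m _ <-] /=; rewrite seriesEnat /= big_mkord.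
apply: le_trans (ler_wpM2l (ltW C0) (hB m)); rewrite mulr_sumr.
apply: ler_sum => k _; have -> : telescope P k = P k * step_ratio T k x - P k by
  rewrite /telescope /P /= big_ord_recr.
have /andP[cP PC] := hC k x.
rewrite (_ : _ - _ = P k * (step_ratio T k x - 1)); last by ring.
rewrite normrM; apply: ler_wpM2r => //.
by rewrite ger0_norm// (le_trans _ cP)// ltW.
Qed.

Lemma prod_ratio_gt0 (x : K) : 0 < prod_ratio T x.
Proof.
have [c [C [c0 C0 hC]]] := prod_ratio_bounds.
apply: lt_le_trans c0 _; apply: limr_ge.
  by apply/cvg_ex; eexists; exact: cvg_prod_ratio.
by apply: nearW => m; have /andP[] := hC m x.
Qed.

End ProductRatio.

(** * The shift carries the squared weight of each $S_j$ to the Markov measure *)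

Section RepWeight.
Context {R : realType} {n : nat}.
Local Notation N := n.+2.
Local Notation K := (words n).
Variables (lam : 'rV[R]_N) (T : nat -> 'M[R]_N) (mu : probability K R).
Hypotheses (lamT : markov_data lam T) (muM : markov_measure lam T mu).
Hypothesis qT : quasi_stationary T.

Let T_gt0 k i j : 0 < T k i j. Proof. by case: lamT. Qed.
Let lam_gt0 i : 0 < lam ord0 i. Proof. by case: lamT => -[]. Qed.

Let ratio k : 'M[R]_N := \matrix_(i, j) (T k i j / T k.+1 i j).

Definition initial_ratio (a b : 'I_N) : R := lam ord0 b / (lam ord0 a * T 0 a b).

Lemma initial_ratio_gt0 a b : 0 < initial_ratio a b.
Proof. by rewrite divr_gt0// mulr_gt0. Qed.

(** The square of the weight of $S_j$ with the infinite product cut off: a word of [m.+2] letters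
    carries [m] factors. On words with fewer than two letters the value 0 is a mere default. *)
Definition trunc_weight (j : 'I_N) (I : seq 'I_N) : R :=
  if I is a :: b :: J then
    (a == j)%:R * (initial_ratio a b * path_weight ratio 0 b J) else 0.

Lemma map_iota_shift (y : K) k m :
  [seq y i | i <- iota k.+1 m] = [seq word_shift y i | i <- iota k m].
Proof. by rewrite -(add1n k) iotaDl -map_comp. Qed.

Lemma path_weight_ratio l m (y : K) :
  path_weight ratio l (y 0%N) (mkseq (word_shift y) m) =
  \prod_(k < m) ratio (l + k)%N (y k) (y k.+1).
Proof.
elim: m l y => [|m IH] l y; first by rewrite big_ord0.
rewrite big_ord_recl /= addn0; congr (_ * _).
rewrite map_iota_shift.
rewrite [LHS](IH l.+1 (word_shift y)); apply: eq_bigr => k _.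
by rewrite /bump /= add1n addSn addnS.
Qed.

Lemma trunc_weightE j m (x : K) : trunc_weight j (mkseq x m.+2) =
  (x 0%N == j)%:R * (initial_ratio (x 0%N) (x 1%N) *
     \prod_(k < m) step_ratio T k (word_shift x)).
Proof.
rewrite /trunc_weight /=; congr (_ * (_ * _)).
rewrite map_iota_shift map_iota_shift [LHS](path_weight_ratio 0 m (word_shift x)).
by apply: eq_bigr => k _; rewrite mxE.
Qed.

Lemma trunc_weight_ge0 j I : 0 <= trunc_weight j I.
Proof.
case: I => [//|a [//|b J]] /=; rewrite mulr_ge0// mulr_ge0//.
  exact/ltW/initial_ratio_gt0.
apply/ltW/path_weight_gt0 => k i l; by rewrite mxE divr_gt0.
Qed.

(** The ratios turn the matrices $T^{(k+1)}$ along a path into $T^{(k)}$, which undoes the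
    displacement of positions caused by the shift. *)
Lemma path_weight_ratioM I k b :
  path_weight ratio k b I * path_weight T k.+1 b I = path_weight T k b I.
Proof.
elim: I k b => [|i I IH] k b /=; first by rewrite mulr1.
rewrite -(IH k.+1 i) mxE; have := lt0r_neq0 (T_gt0 k.+1 b i) => h; by field.
Qed.

Lemma rep_weight_sqr j (x : K) : rep_weight lam T j x ^+ 2 =
  (x 0%N == j)%:R * (initial_ratio (x 0%N) (x 1%N) * prod_ratio T (word_shift x)).
Proof.
rewrite /rep_weight exprMn sqr_sqrtr; last first.
  by rewrite mulr_ge0 ?ltW// ?initial_ratio_gt0// (prod_ratio_gt0 lamT qT).
by case: eqP => _; rewrite ?expr1n ?expr0n.
Qed.

Lemma cvg_trunc_weight j (x : K) :
  trunc_weight j (mkseq x m.+2) @[m --> \oo] --> rep_weight lam T j x ^+ 2.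
Proof.
under eq_fun do rewrite trunc_weightE; rewrite rep_weight_sqr.
by apply: cvgMr; apply: cvgMr; exact: (cvg_prod_ratio lamT qT).
Qed.

Lemma rep_weight_ge0 j (x : K) : 0 <= rep_weight lam T j x.
Proof. by rewrite mulr_ge0// sqrtr_ge0. Qed.

Lemma rep_weight_gt0 j (x : K) : x 0%N = j -> 0 < rep_weight lam T j x.
Proof.
move=> xj; rewrite /rep_weight xj eqxx mul1r sqrtr_gt0 mulr_gt0//.
  exact: initial_ratio_gt0.
exact: (prod_ratio_gt0 lamT qT).
Qed.

Lemma rep_weight_neq0 j (x : K) : (rep_weight lam T j x != 0) = (x 0%N == j).
Proof.
have [xj|xj] := eqVneq (x 0%N) j; first by rewrite gt_eqF// rep_weight_gt0.
by rewrite /rep_weight (negbTE xj) mul0r eqxx.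
Qed.

Lemma measurable_rep_weight_sqr j :
  measurable_fun setT (fun x : K => rep_weight lam T j x ^+ 2).
Proof.
have h m : measurable_fun setT (fun x : K => trunc_weight j (mkseq x m.+2)).
  exact: measurable_prefix_fun.
by refine (measurable_fun_cvg h _) => x _; exact: cvg_trunc_weight.
Qed.

Lemma measurable_rep_weight j : measurable_fun setT (rep_weight lam T j : K -> R).
Proof.
have -> : rep_weight lam T j = Num.sqrt \o (fun x : K => rep_weight lam T j x ^+ 2).
  by apply/funext => x /=; rewrite sqrtr_sqr ger0_norm// rep_weight_ge0.
have ms : measurable_fun setT (Num.sqrt : R -> R) by exact:
  continuous_measurable_fun (@sqrt_continuous R).
exact: (measurableT_comp ms (measurable_rep_weight_sqr j)).
Qed.

(** On a word $jbJ$, [initial_ratio] replaces the first two factors of the Markov weight by that of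
    the initial letter [b], and the ratios move the remaining matrices back by one position. What is
    left is the weight of $bJ$, so that truncation causes no error on sets of this length. *)
Lemma integral_trunc_weight j m (Q : pred (seq 'I_N)) :
  (\int[mu]_(x in word_shift @^-1` prefix_set m.+1 Q) (trunc_weight j (mkseq x
    m.+2))%:E)%E
  = mu (prefix_set m.+1 Q).
Proof.
rewrite integral_mkcond (markov_prefix_set muM).
pose g I := trunc_weight j I * (Q (behead I))%:R.
transitivity (\int[mu]_x (g (mkseq x m.+2))%:E)%E.
  apply: eq_integral => x _; rewrite patchE /g.
  have E : behead (mkseq x m.+2) = mkseq (word_shift x) m.+1.
    by rewrite /mkseq /= !map_iota_shift.
  rewrite E; have [Qx|Qx] := boolP (Q (mkseq (word_shift x) m.+1)).
    by rewrite mem_set// mulr1.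
  by rewrite memNset ?mulr0//= /prefix_set /=; exact/negP.
rewrite (integral_prefix muM); last first.
  by move=> I; rewrite mulr_ge0// trunc_weight_ge0.
congr EFin; rewrite (big_tupleS m.+1 (fun I => g I * markov_weight lam T I)) /=.
rewrite (bigD1 j) //= [X in _ + X]big1 ?addr0; last first.
  move=> a aj; apply: big1 => J _; rewrite /g /=.
  case: (tval J) => [|b J'] /=; first by rewrite !mul0r.
  by rewrite (negbTE aj) !mul0r.
rewrite [RHS]big_mkcond /=.
rewrite (big_tupleS m (fun I => g (j :: I) * (lam ord0 j * path_weight T 0 j I))).
rewrite (big_tupleS m (fun I => if Q I then markov_weight lam T I else 0)).
apply: eq_bigr => b _; apply: eq_bigr => J _; rewrite /g /= eqxx mul1r.
case: (Q (b :: J)); last by rewrite mulr0 mul0r.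
rewrite mulr1 -(path_weight_ratioM J 0 b) /initial_ratio.
by field; rewrite !lt0r_neq0.
Qed.

(** The integrals of the truncated weights are eventually constant and equal to the right-hand side.
    Dominated convergence applies with the constant [G], which adds up the bounds for all pairs of
    first letters. *)
Lemma integral_rep_weight_prefix j m (Q : pred (seq 'I_N)) :
  (\int[mu]_(x in word_shift @^-1` prefix_set m Q) (rep_weight lam T j x ^+ 2)%:E)%E
  = mu (prefix_set m Q).
Proof.
set D := _ @^-1` _; have mD : measurable D.
  rewrite -[D]setTI; apply: measurable_word_shift => //.
  exact: measurable_prefix_set.
have [c [C [c0 C0 hC]]] := prod_ratio_bounds lamT qT.
pose G := \sum_a \sum_b initial_ratio a b * C.
have [] := @dominated_convergence _ _ R mu D mD
  (fun m x => (trunc_weight j (mkseq x m.+2))%:E)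
  (fun x => (rep_weight lam T j x ^+ 2)%:E) (fun=> G%:E).
- move=> k; apply/measurable_EFinP/measurable_funTS.
  exact: measurable_prefix_fun.
- apply/measurable_EFinP/measurable_funTS; exact: measurable_rep_weight_sqr.
- by apply: aeW => x _; apply: cvg_EFin; [exact: nearW|exact: cvg_trunc_weight].
- apply: (integrableS measurableT) => //; exact: finite_measure_integrable_cst.
- apply: aeW => x k _; rewrite gee0_abs ?lee_fin ?trunc_weight_ge0//.
  rewrite trunc_weightE; have /andP[_ PC] := hC k (word_shift x).
  have P0 : 0 <= \prod_(l < k) step_ratio T l (word_shift x).
    by apply: prodr_ge0 => l _; rewrite ltW// divr_gt0.
  have i0 a b : 0 <= initial_ratio a b * C by rewrite mulr_ge0// ltW//
    initial_ratio_gt0.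
  apply: (@le_trans _ _ (initial_ratio (x 0%N) (x 1%N) * C)).
    have ir0 := ltW (initial_ratio_gt0 (x 0%N) (x 1%N)).
    by case: eqP => _; rewrite ?mul0r ?mul1r//; apply: ler_wpM2l.
  rewrite /G (bigD1 (x 0%N)) //= (bigD1 (x 1%N)) //= -addrA lerDl addr_ge0//.
    by apply: sumr_ge0.
  by apply: sumr_ge0 => a _; apply: sumr_ge0.
move=> _ _ h; apply: (cvg_unique (@ereal_hausdorff R) h); apply: cvg_near_cst.
exists m => // k /= mk; have mk1 := leq_trans mk (leqnSn k).
rewrite /D (prefix_set_widen Q mk1); exact: integral_trunc_weight.
Qed.

(** The identity on prefix sets extends to Borel sets by a Dynkin argument, where complements use
    that both sides have total mass 1. *)
Lemma rep_weight_isometric j :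
  isometric_weight mu mu (rep_weight lam T j) (@word_shift n).
Proof.
apply: isometric_weightP; [exact: measurable_rep_weight|exact:
  measurable_word_shift|].
have mw : measurable_fun setT (fun x : K => (rep_weight lam T j x ^+ 2)%:E).
  apply/measurable_EFinP; exact: measurable_rep_weight_sqr.
have w0 x : (0 <= (rep_weight lam T j x ^+ 2)%:E :> \bar R)%E.
  by rewrite lee_fin sqr_ge0.
have mpre A : measurable A -> measurable (@word_shift n @^-1` A).
  by move=> mA; rewrite -[_ @^-1` _]setTI; exact: measurable_word_shift.
have wT : (\int[mu]_x (rep_weight lam T j x ^+ 2)%:E = 1)%E.
  by rewrite -(probability_setT mu) prefix_setT -(integral_rep_weight_prefix j).
pose P (A : set K) :=
  (\int[mu]_(x in @word_shift n @^-1` A) (rep_weight lam T j x ^+ 2)%:E)%E = mu A.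
move=> A; rewrite -/(P A) measurable_wordsE; apply: dynkin_induction.
- exact: measurable_wordsE.
- exact: prefix_sets_setI.
- by rewrite /P preimage_setT wT; exact/esym/probability_setT.
- by move=> _ [m [Q ->]]; exact: integral_rep_weight_prefix.
- rewrite /P => S mS hS.
  have E : (\int[mu]_(x in word_shift @^-1` S) (rep_weight lam T j x ^+ 2)%:E +
    \int[mu]_(x in word_shift @^-1` (~` S)) (rep_weight lam T j x ^+ 2)%:E = 1)%E.
    rewrite -ge0_integral_setU//.
    + by rewrite -preimage_setU setUv preimage_setT.
    + exact: mpre.
    + by apply: mpre; exact: measurableC.
    + exact: measurable_funTS.
    + by apply/disj_setPS => x [].
  rewrite probability_setC// -E hS addeAC subee ?add0e//.
  exact: fin_num_measure.
- rewrite /P => F mF tF hF; rewrite preimage_bigcup ge0_integral_bigcup//.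
  + rewrite measure_bigcup//; apply: congr_lim; apply/funext => m.
    by apply: eq_big => [k|k _]; [rewrite in_setT|exact: hF].
  + by move=> k; exact: mpre.
  + exact: measurable_funTS.
  + by move=> i k _ _ [x [Fi Fk]]; apply: tF => //; exists (word_shift x).
Qed.

End RepWeight.

(** * Intertwining operators *)

Section IsometricWeights.
Context {d1 d2 d3 : measure_display} {T1 : measurableType d1}.
Context {T2 : measurableType d2} {T3 : measurableType d3} {R : realType}.
Variables (mu1 : {measure set T1 -> \bar R}) (mu2 : {measure set T2 -> \bar R}).
Variable (mu3 : {measure set T3 -> \bar R}).

Lemma isometric_comp (w : T2 -> R) (t : T2 -> T1) (v : T3 -> R) (s : T3 -> T2) :
  isometric_weight mu1 mu2 w t -> isometric_weight mu2 mu3 v s ->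
  isometric_weight mu1 mu3 (fun x => v x * w (s x)) (t \o s).
Proof.
move=> [mw mt cw] [mv ms cv]; split.
- by apply: measurable_funM => //; exact: measurableT_comp.
- exact: measurableT_comp.
move=> f mf f0; rewrite -cw// -cv.
- by apply: eq_integral => x _ /=; rewrite exprMn EFinM muleA.
- apply: emeasurable_funM; last exact: (measurableT_comp mf mt).
  by apply/measurable_EFinP; exact: measurable_funX.
- by move=> x; rewrite mule_ge0// lee_fin sqr_ge0.
Qed.

(* Where the weights do not vanish [t] is injective with inverse [s], so the
   weights are determined by the images under [t] of the measures they induce. *)
Lemma isometric_weight_unique (w w' : T2 -> R) (t : T2 -> T1) (s : T1 -> T2) :
  (mu1 setT < +oo)%E -> measurable_fun setT s ->
  isometric_weight mu1 mu2 w t -> isometric_weight mu1 mu2 w' t ->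
  (forall x, 0 <= w x) -> (forall x, 0 <= w' x) ->
  (forall x, w x != 0 -> s (t x) = x) -> (forall x, w' x != 0 -> s (t x) = x) ->
  {ae mu2, forall x, w x = w' x}.
Proof.
move=> fin ms iw iw' w0 w'0 ws w's.
(* The mass that the squared weight gives to [E] equals an expression in [mu1], [s] and [E] in which
   the weight no longer occurs. *)
have onset (v : T2 -> R) E : isometric_weight mu1 mu2 v t ->
    (forall x, v x != 0 -> s (t x) = x) -> measurable E ->
    (\int[mu2]_(x in E) (v x ^+ 2)%:E = \int[mu1]_x (\1_E (s x) : R)%:E)%E.
  move=> [mv mt iv] vs mE; rewrite -iv//; last first.
    have mi : measurable_fun setT (\1_E : T2 -> R) by exact: measurable_indic.
    by apply/measurable_EFinP; exact: (measurableT_comp mi ms).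
  rewrite integral_mkcond; apply: eq_integral => x _; rewrite epatch_indic.
  have [->|vx] := eqVneq (v x) 0; first by rewrite expr0n !mul0e.
  by rewrite vs.
have msq (v : T2 -> R) : isometric_weight mu1 mu2 v t ->
    measurable_fun setT (fun x => (v x ^+ 2)%:E).
  by move=> [mv _ _]; apply/measurable_EFinP; exact: measurable_funX.
have : ae_eq mu2 setT (fun x => (w x ^+ 2)%:E) (fun x => (w' x ^+ 2)%:E).
  apply: integral_ae_eq => //; last 2 first.
  - exact: msq.
  - by move=> E _ mE; rewrite (onset w)// (onset w').
  apply/integrableP; split; first exact: msq.
  have [_ _ /(_ (cst 1%E))] := iw.
  under eq_integral do rewrite mule1; rewrite integral_cst// mul1e => h.
  under eq_integral do rewrite gee0_abs ?lee_fin ?sqr_ge0//.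
  by rewrite h// => x; rewrite lee_fin.
apply: filterS => x /(_ I) [] /eqP; rewrite eqrXn2// => /eqP.
exact.
Qed.

End IsometricWeights.

(** * The measure with density $|u|^2$ *)

Section Density.
Context {d : measure_display} {T : measurableType d} {R : realType}.
Variables (mu : {measure set T -> \bar R}) (u : L2 mu).
Local Open Scope ereal_scope.

(** Giving $|u|^2\mu$ the structure of a measure makes [null_dominates_prefix_set] applicable to
    it. *)
Definition sqmod_density (A : set T) : \bar R :=
  \int[mu]_(x in A) (sqmod (evL2 (repr u) x))%:E.

Let msq : measurable_fun setT (fun x => (sqmod (evL2 (repr u) x))%:E).
Proof. exact: measurable_int (integrable_sqmod u). Qed.

Let sq0 x : 0 <= (sqmod (evL2 (repr u) x))%:E.
Proof. by rewrite lee_fin sqmod_ge0. Qed.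

Let density0 : sqmod_density set0 = 0.
Proof. exact: integral_set0. Qed.

Let density_ge0 A : 0 <= sqmod_density A.
Proof. exact: integral_ge0. Qed.

Let density_sigma_additive : semi_sigma_additive sqmod_density.
Proof.
move=> F mF tF mU; rewrite /sqmod_density ge0_integral_bigcup//; last first.
  exact: measurable_funTS.
by apply: is_cvg_nneseries => k _ _; exact: integral_ge0.
Qed.

HB.instance Definition _ := isMeasure.Build _ _ _ sqmod_density
  density0 density_ge0 density_sigma_additive.

Lemma sqmod_density_lty : sqmod_density setT < +oo.
Proof. by have /finL2P[_ _] := finL2_repr u. Qed.

Lemma sqmod_density_null A : measurable A -> mu A = 0 -> sqmod_density A = 0.
Proof.
move=> mA A0; apply: null_set_integral => //.
exact: measurable_funTS msq.
Qed.

Lemma sqmod_density_eq0 : sqmod_density setT = 0 -> u = 0%R.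
Proof.
move=> h; apply/eqL2P.
have : \int[mu]_x `|(sqmod (evL2 (repr u) x))%:E| = 0.
  by under eq_integral do rewrite gee0_abs//.
move=> /(ae_eq_integral_abs mu measurableT msq) h0.
apply: filterS (ae_and h0 (evL2_0 mu)) => x [/(_ I) [] /sqmod_eq0 ->].
by move=> ->.
Qed.

Lemma dotL2_density : dotL2 mu u u = (fine (sqmod_density setT))%:C%C.
Proof. by rewrite dotL2_sqmod. Qed.

End Density.

Lemma contractive_indic {d : measure_display} {T : measurableType d} {R : realType}
    (mu : {measure set T -> \bar R}) (A : set T) : measurable A ->
  contractive_weight mu mu (\1_A : T -> R) id.
Proof.
move=> mA; apply: contractive_bounded; first exact: measurable_indic.
by move=> x; rewrite indicE; case: (_ \in _); rewrite ?normr1 ?normr0.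
Qed.

Lemma sqmod_density_indic {d : measure_display} {T : measurableType d} {R :
  realType}
    (mu : {measure set T -> \bar R}) (u : L2 mu) (A : set T) : measurable A ->
  sqmod_density (wcomp mu (\1_A : T -> R) id u) setT = sqmod_density u A.
Proof.
move=> mA; have cA := contractive_indic mu mA.
rewrite /sqmod_density [RHS]integral_mkcond; apply: ae_eq_integral => //.
- exact: measurable_int (integrable_sqmod _).
- apply/(measurable_restrictT _ mA); apply: measurable_funTS.
  exact: measurable_int (integrable_sqmod _).
apply: filterS (ae_wcomp cA u) => x E _; rewrite E sqmodM patchE indicE.
by case: (_ \in _); rewrite ?expr1n ?mul1r// expr0n mul0r.
Qed.

(** * The adjoints of the generators and the projections onto cylinders *)

Section Adjoint.
Context {R : realType} {n : nat}.
Local Notation N := n.+2.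
Local Notation K := (words n).
Variables (lam : 'rV[R]_N) (T : nat -> 'M[R]_N) (mu : probability K R).
Hypotheses (lamT : markov_data lam T) (muM : markov_measure lam T mu).
Hypothesis qT : quasi_stationary T.

(** The weight of the adjoint: $(S_j^* g)(x) = g(jx)/f_j(jx)$, where $f_j(jx) > 0$. *)
Definition rep_coweight (j : 'I_N) (x : K) : R := (rep_weight lam T j (word_cons
  j x))^-1.

Lemma measurable_rep_coweight j : measurable_fun setT (rep_coweight j).
Proof.
have mw := measurableT_comp (measurable_rep_weight lamT qT j)
  (measurable_word_cons j).
have -> : rep_coweight j = (@powR R ^~ (-1)) \o (rep_weight lam T j \o word_cons j).
  by apply/funext => x; rewrite /= powR_inv1// rep_weight_ge0.
exact: (measurableT_comp (measurable_powR _) mw).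
Qed.

Lemma rep_weight_cons j (x : K) : rep_weight lam T j x != 0 ->
  word_cons j (word_shift x) = x.
Proof. by rewrite (rep_weight_neq0 lamT qT) => /eqP <-; exact: word_shiftK. Qed.

Lemma rep_weight_inverse j :
  weight_inverse (rep_weight lam T j) (@word_shift n) (rep_coweight j) (word_cons
    j).
Proof.
by move=> x wx; have xE := rep_weight_cons wx; rewrite /rep_coweight xE mulfV.
Qed.

Lemma markov_repE j :
  markov_rep lam T mu j = wcomp mu (rep_weight lam T j) (@word_shift n).
Proof. by []. Qed.

Lemma markov_rep_adjoint j : adjoint (dotL2 mu) (markov_rep lam T mu j) =
  wcomp mu (rep_coweight j) (word_cons j).
Proof.
apply: adjointE => u v; apply: dot_wcomp_adjoint.
- exact: rep_weight_isometric.
- exact: rep_weight_inverse.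
- exact: measurable_rep_coweight.
- exact: measurable_word_cons.
Qed.

Lemma measurable_cylinder (I : seq 'I_N) : measurable (cylinder I : set K).
Proof. by rewrite cylinderE; exact: measurable_prefix_set. Qed.

Lemma cylinder_cons j I (x : K) :
  cylinder (j :: I) x <-> x 0%N = j /\ cylinder I (word_shift x).
Proof.
rewrite /cylinder /mkseq /= map_iota_shift.
by split=> [[-> ->]|[-> ->]].
Qed.

(** This is $1_{C(jI)} = S_j 1_{C(I)} S_j^*$, the recursion behind $1_{C(I)} = S_I S_I^*$. The three
    weights multiply to 1 on $C(jI)$ and to 0 elsewhere, and prepending [j] after the shift is the
    identity there. *)
Lemma markov_rep_cylinder j I (u : L2 mu) :
  wcomp mu (\1_(cylinder (j :: I)) : K -> R) id u =
  markov_rep lam T mu j (wcomp mu (\1_(cylinder I) : K -> R) id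
    (adjoint (dotL2 mu) (markov_rep lam T mu j) u)).
Proof.
have iw := rep_weight_isometric lamT muM qT j.
have cw := isometric_contractive iw.
have cv := contractive_inverse iw (rep_weight_inverse (j := j))
  (measurable_rep_coweight j) (measurable_word_cons j).
have cI := contractive_indic mu (measurable_cylinder I).
rewrite markov_rep_adjoint markov_repE (wcomp_comp _ cv cI).
rewrite (wcomp_comp _ (contractive_comp cv cI) cw).
apply: eq_wcomp.
- by apply: contractive_indic; exact: measurable_cylinder.
- exact: contractive_comp (contractive_comp cv cI) cw.
- apply: aeW => x; have [wx|wx] := eqVneq (rep_weight lam T j x) 0.
    rewrite wx mul0r indicE memNset// => /cylinder_cons[xj _].
    by move/eqP: wx; apply/negP; rewrite (rep_weight_neq0 lamT qT) xj.
  have [h _] := rep_weight_inverse wx; rewrite mulrCA h mulr1 !indicE.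
  congr (_%:R); congr nat_of_bool; apply/idP/idP; rewrite !inE.
    by move=> /cylinder_cons[].
  move=> hI; apply/cylinder_cons; split=> //.
  by move: wx; rewrite (rep_weight_neq0 lamT qT) => /eqP.
move=> x; rewrite indicE; have [|_] := boolP (_ \in _); last by rewrite eqxx.
by rewrite inE => /cylinder_cons[<- _] _ /=; rewrite word_shiftK.
Qed.

End Adjoint.

(** * Intertwiners when the measures are singular *)

Section Representations.
Context {R : realType} {n : nat}.
Local Notation N := n.+2.
Local Notation K := (words n).
Variables (lam lam' : 'rV[R]_N) (T T' : nat -> 'M[R]_N) (mu mu' : probability K R).
Hypotheses (lamT : markov_data lam T) (lamT' : markov_data lam' T').
Hypotheses (muM : markov_measure lam T mu) (muM' : markov_measure lam' T' mu').
Hypotheses (qT : quasi_stationary T) (qT' : quasi_stationary T').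
Local Notation S := (markov_rep lam T mu).
Local Notation S' := (markov_rep lam' T' mu').

(** Induction on the word: [W] passes through $S_j$, the shorter cylinder and $S_j^*$ in turn. For
    the empty word the projection is the identity. *)
Lemma intertwiner_cylinder (W : L2 mu -> L2 mu') :
  (forall j, W \o S j = S' j \o W) ->
  (forall j, W \o adjoint (dotL2 mu) (S j) = adjoint (dotL2 mu') (S' j) \o W) ->
  forall I u, W (wcomp mu (\1_(cylinder I) : K -> R) id u) =
    wcomp mu' (\1_(cylinder I) : K -> R) id (W u).
Proof.
move=> WS WS' ; elim=> [|j I IH] u.
  have -> : \1_(cylinder [::] : set K) = cst 1 :> (K -> R).
    by apply/funext => x; rewrite indicE mem_set.
  by rewrite !wcomp1.
rewrite (markov_rep_cylinder lamT muM qT) (markov_rep_cylinder lamT' muM' qT').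
have E v : W (S j v) = S' j (W v) by exact: (congr1 (fun f => f v) (WS j)).
have E' v : W (adjoint (dotL2 mu) (S j) v) = adjoint (dotL2 mu') (S' j) (W v).
  exact: (congr1 (fun f => f v) (WS' j)).
by rewrite E IH E'.
Qed.

Lemma bounded_density (W : {linear L2 mu -> L2 mu'}) :
  bounded_operator (dotL2 mu) (dotL2 mu') W -> exists M : R, forall u,
  (sqmod_density (W u) setT <= (M ^+ 2)%:E * sqmod_density u setT)%E.
Proof.
move=> [M hM]; exists M => u.
have fin v : sqmod_density (v : L2 mu) setT \is a fin_num.
  by rewrite ge0_fin_numE// sqmod_density_lty.
have fin' v : sqmod_density (v : L2 mu') setT \is a fin_num.
  by rewrite ge0_fin_numE// sqmod_density_lty.
have : sqrtC (dotL2 mu' (W u) (W u)) <= M%:C%C * sqrtC (dotL2 mu u u) := hM u.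
rewrite !dotL2_density.
set a := fine (sqmod_density (W u) setT); set b := fine (sqmod_density u setT).
have a0 : 0 <= a by exact: fine_ge0.
have b0 : 0 <= b by exact: fine_ge0.
rewrite -(fineK (fin' (W u))) -(fineK (fin u)) -EFinM lee_fin -/a -/b => h.
(* [M] may have any sign; squaring is allowed because the right-hand side dominates a norm and so is
   nonnegative. *)
have : sqrtC a%:C%C ^+ 2 <= (M%:C%C * sqrtC b%:C%C) ^+ 2.
  by rewrite ler_sqr ?nnegrE ?sqrtC_ge0 ?ler0c// (le_trans _ h)// sqrtC_ge0 ler0c.
by rewrite exprMn !sqrtCK -rmorphXn -rmorphM /= lecR.
Qed.

Lemma singular_disjoint : mutually_singular mu mu' ->
  disjoint_representations (dotL2 mu) (dotL2 mu') S S'.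
Proof.
move=> [A [mA A0 A'0]] W /bounded_density[M hM] WS WS' u.
have Wcyl := intertwiner_cylinder WS WS'.
pose nu := sqmod_density u; pose nu' := sqmod_density (W u).
(* The norm bound is applied to [u] cut down to the cylinder, which [W] maps to [W u] cut down to
   the same cylinder. *)
have cyl I : (nu' (cylinder I) <= (M ^+ 2)%:E * nu (cylinder I))%E.
  have mI := measurable_cylinder (n := n) I.
  have := hM (wcomp mu (\1_(cylinder I) : K -> R) id u).
  by rewrite Wcyl !sqmod_density_indic.
have pre m P : (nu' (prefix_set m P) <= (M ^+ 2)%:E * nu (prefix_set m P))%E.
  rewrite /nu /nu' !measure_prefix_set ge0_sume_distrr//.
  by apply: lee_sum => I _; exact: cyl.
have dom : sqmod_density (W u) `<< sqmod_density u.
  apply: null_dominates_prefix_set; [exact: sqmod_density_lty|exact: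
    sqmod_density_lty|].
  (* The 1 keeps the denominator positive when [M] is 0. *)
  move=> e e0; exists (e / (M ^+ 2 + 1)).
    by rewrite divr_gt0// ltr_wpDl// sqr_ge0.
  move=> m P h; apply: le_trans (pre m P) _.
  apply: le_trans (lee_wpmul2l _ h) _; first by rewrite lee_fin sqr_ge0.
  rewrite -EFinM lee_fin mulrCA -[leRHS]mulr1; apply: ler_wpM2l; first exact: ltW.
  rewrite ler_pdivrMr ?mul1r ?lerDl//; first by rewrite ltr_wpDl// sqr_ge0.
move/null_content_dominatesP : dom => dom.
(* The set [A] is null for $|u|^2\mu$, hence by domination for $|Wu|^2\mu'$; its complement is null
   already for $\mu'$. *)
have nuA : sqmod_density (W u) A = 0%E := dom _ mA (sqmod_density_null u mA A0).
have nuC : sqmod_density (W u) (~` A) = 0%E.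
  by apply: sqmod_density_null => //; exact: measurableC.
apply: sqmod_density_eq0; rewrite -(setvU A).
transitivity (sqmod_density (W u) (~` A) + sqmod_density (W u) A)%E.
  by apply: measureU; [exact: measurableC|exact: mA|rewrite setICl].
by rewrite nuA nuC adde0.
Qed.

End Representations.

(** * The unitary given by a Radon-Nikodym derivative *)

Section RadonNikodymOperator.
Context {d : measure_display} {X : measurableType d} {R : realType}.

(** The witness is $\sqrt{d\mu/d\nu}$, and the isometry condition is the change of measure
    formula. *)
Lemma dominated_isometric_weight (mu nu : probability X R) : mu `<< nu ->
  exists g : X -> R, (forall x, 0 <= g x) /\ isometric_weight mu nu g id.
Proof.
move=> mn; pose f := Radon_Nikodym_SigmaFinite.f mu nu.
have f0 x : (0 <= f x)%E by exact: Radon_Nikodym_SigmaFinite.f_ge0.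
have ffin x : f x \is a fin_num by exact: Radon_Nikodym_SigmaFinite.f_fin_num.
have mf : measurable_fun setT f.
  exact: measurable_int (Radon_Nikodym_SigmaFinite.f_integrable mn).
exists (fun x => Num.sqrt (fine (f x))); split=> [x|]; first exact: sqrtr_ge0.
split=> //.
  have ms : measurable_fun setT (Num.sqrt : R -> R).
    exact: continuous_measurable_fun (@sqrt_continuous R).
  by apply: (measurableT_comp ms); exact: measurableT_comp.
move=> h mh h0; rewrite -(Radon_Nikodym_SigmaFinite.change_of_variables mn h0
  measurableT mh).
apply: eq_integral => x _; rewrite sqr_sqrtr ?fine_ge0//.
by rewrite fineK// muleC.
Qed.

Lemma isometric_weight_id (nu : probability X R) : isometric_weight nu nu (cst 1)
  id.
Proof.
split=> // f mf f0; apply: eq_integral => x _.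
by rewrite expr1n mul1e.
Qed.

(** The product of the two weights and the constant 1 are both isometric from [mu] to itself over
    the identity map, so they agree almost everywhere by uniqueness. *)
Lemma weight_cancel (mu nu : probability X R) (g h : X -> R) :
  (forall x, 0 <= g x) -> (forall x, 0 <= h x) ->
  isometric_weight mu nu g id -> isometric_weight nu mu h id ->
  forall u, wcomp mu h id (wcomp nu g id u) = u.
Proof.
move=> g0 h0 ig ih u.
have cg := isometric_contractive ig; have ch := isometric_contractive ih.
have igh := isometric_comp ig ih.
rewrite (wcomp_comp u cg ch) -[RHS]wcomp1; apply: eq_wcomp => //.
- exact: isometric_contractive igh.
- exact/isometric_contractive/isometric_weight_id.
have fin : (mu setT < +oo)%E by rewrite probability_setT ltry.
apply: (isometric_weight_unique fin _ igh (isometric_weight_id mu) (s := id)) => //.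
by move=> x; rewrite mulr_ge0.
Qed.

End RadonNikodymOperator.

Lemma equivalent_measures_representations {R : realType} {n : nat}
    (lam lam' : 'rV[R]_n.+2) (T T' : nat -> 'M[R]_n.+2)
    (mu mu' : probability (words n) R) :
  markov_data lam T -> markov_data lam' T' ->
  markov_measure lam T mu -> markov_measure lam' T' mu' ->
  quasi_stationary T -> quasi_stationary T' -> equivalent_measures mu mu' ->
  equivalent_representations (dotL2 mu) (dotL2 mu')
    (markov_rep lam T mu) (markov_rep lam' T' mu').
Proof.
move=> lamT lamT' muM muM' qT qT' [mm' m'm].
have [g [g0 ig]] := dominated_isometric_weight mm'.
have [h [h0 ih]] := dominated_isometric_weight m'm.
have cg := isometric_contractive ig.
pose W : {linear L2 mu -> L2 mu'} := HB.pack (wcomp mu' g id)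
  (GRing.isLinear.Build _ _ _ _ (wcomp mu' g id) (wcomp_linear cg)).
exists W; split.
  split; last by move=> u v; exact: dot_wcomp_isometry.
  by exists (wcomp mu h id) => u; apply: weight_cancel.
move=> j; apply/funext => u /=; rewrite !markov_repE.
have iw := rep_weight_isometric lamT muM qT j.
have iw' := rep_weight_isometric lamT' muM' qT' j.
have cw := isometric_contractive iw; have cw' := isometric_contractive iw'.
rewrite (wcomp_comp u cw cg) (wcomp_comp u cg cw').
have i1 := isometric_comp iw ig; have i2 := isometric_comp ig iw'.
apply: eq_wcomp => //; [exact: isometric_contractive i1|exact:
  isometric_contractive i2|].
have fin : (mu setT < +oo)%E by rewrite probability_setT ltry.
(* Both products are isometric over the shift, which [word_cons j] inverts wherever either weight is
   nonzero. Uniqueness thus yields the cocycle identity between the two weights without computing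
   the infinite products. *)
apply: (isometric_weight_unique fin (measurable_word_cons j) i1 i2).
- by move=> x; rewrite mulr_ge0// rep_weight_ge0.
- by move=> x; rewrite mulr_ge0// rep_weight_ge0.
- by move=> x; rewrite mulf_eq0 negb_or => /andP[_ /(rep_weight_cons lamT qT)].
- by move=> x; rewrite mulf_eq0 negb_or => /andP[/(rep_weight_cons lamT' qT') ? _].
Qed.

Theorem theorem4p1 (R : realType) (n : nat)
    (lam lam' : 'rV[R]_n.+2) (T T' : nat -> 'M[R]_n.+2)
    (mu mu' : probability (words n) R)
    (lamT : markov_data lam T) (lamT' : markov_data lam' T')
    (muM : markov_measure lam T mu) (muM' : markov_measure lam' T' mu')
    (qT : quasi_stationary T) (qT' : quasi_stationary T') :
  (equivalent_measures mu mu' \/ mutually_singular mu mu') /\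
  (equivalent_representations (dotL2 mu) (dotL2 mu')
     (markov_rep lam T mu) (markov_rep lam' T' mu') \/
   disjoint_representations (dotL2 mu) (dotL2 mu')
     (markov_rep lam T mu) (markov_rep lam' T' mu')).
Proof.
have [eqm|sing] := equivalent_or_singular lamT lamT' muM muM' qT qT'.
  by split; left => //; exact: equivalent_measures_representations.
by split; right => //; exact: singular_disjoint.
Qed.
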